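(* Let $p$ be a prime, let $G$ be a finite $p$-group, and let $n$ be a non-negative integer such that $|G'| > p^{n(n-1)/2}$. Then $G$ is generated by the set of elements $x \in G$ with $b(x) \geq n$.
   Context: $G'$ denotes the derived (commutator) subgroup of $G$. For $x$ in a finite $p$-group $G$, the breadth $b(x)$ is defined by $|G : C_G(x)| = p^{b(x)}$, where $C_G(x)$ is the centralizer of $x$ in $G$. *)

(* Defs.v *)
From mathcomp Require Import all_boot all_fingroup all_solvable.
Set Implicit Arguments. Unset Strict Implicit. Unset Printing Implicit Defensive.
Local Open Scope group_scope.

Definition breadth (gT : finGroupType) (p : nat) (G : {set gT}) (x : gT) : nat :=
  logn p #|G : 'C_G[x]|.

(* Main.v *)
Require Import Defs.
From mathcomp Require Import all_boot all_fingroup all_solvable.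
From mathcomp Require Import all_algebra all_character.
From mathcomp Require Import zify ring.
Set Implicit Arguments. Unset Strict Implicit. Unset Printing Implicit Defensive.
Import GRing.Theory.
Local Open Scope group_scope.

(** If M is a proper subgroup of G and all elements outside M have breadth at most b,
    then |G'| <= p^(b(b+1)/2).  Take a counterexample with |G| minimal and M maximal.
    Put V = G/Phi(G), D = [Phi(G), G], W = G'/D, let c : V x V -> W be the commutator map
    and u a functional on V with kernel M/Phi(G).

    For each hyperplane al = 0 of V other than u = 0, minimality applied to the
    corresponding maximal subgroup H gives H' < G' and an x in H outside M that is
    central modulo H'.  Hence some functional on W turns c into a nonzero decomposable
    form al /\ be with u, al, be independent.  Counting the pairs (x, al) with u(x) = 1
    and al in the image of the contraction of W* with x bounds the ranks r(x) of c(x, .)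
    from below on average; counting the pairs of commuting vectors bounds them from
    above in terms of dim W.  Together these give a basis x_1, ..., x_n of V inside u = 1
    with r(x_1) = n - 1 and dim W + n(n-1)/2 <= sum_i r(x_i).

    Lift the basis to G and let K = <x_1> Phi(G).  Centralizers of elements of K outside
    Phi(G) lie in K, so minimality bounds |K'| with b replaced by b - (n - 1), and
    [Phi(G), G]/K' is the product of the subgroups [Phi(G), x_i] modulo K' for i > 1,
    of order at most p^(b - r(x_i)).  Multiplying the bounds for W, D/K' and K'
    contradicts the choice of G. *)

(** * Alternating maps over finite fields *)

Section LinearForms.

Local Open Scope ring_scope.

Variables (F : finFieldType) (n : nat).
Implicit Types (x y v : 'rV[F]_n) (al be : 'cV[F]_n).

Definition ev x al : F := (x *m al) 0 0.

Lemma evDl x y al : ev (x + y) al = ev x al + ev y al.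
Proof. by rewrite /ev mulmxDl mxE. Qed.

Lemma evZl a x al : ev (a *: x) al = a * ev x al.
Proof. by rewrite /ev -scalemxAl mxE. Qed.

Lemma evZr a x al : ev x (a *: al) = a * ev x al.
Proof. by rewrite /ev -scalemxAr mxE. Qed.

Lemma ev0r x : ev x 0 = 0.
Proof. by rewrite /ev mulmx0 mxE. Qed.

Lemma evBl x y al : ev (x - y) al = ev x al - ev y al.
Proof. by rewrite -scaleN1r evDl evZl mulN1r. Qed.

Lemma ev_delta i al : ev (delta_mx 0 i) al = al i 0.
Proof. by rewrite /ev -rowE mxE. Qed.

Lemma ev_inj al be : (forall x, ev x al = ev x be) -> al = be.
Proof. by move=> e; apply/colP=> i; rewrite -!ev_delta e. Qed.

(** Translation by a suitable multiple of [v] maps any level of [al] in [S] injectively into any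
    other, so all levels have equal size. *)
Lemma card_level (S : {set 'rV[F]_n}) v al t :
  ev v al != 0 -> (forall x a, x \in S -> x + a *: v \in S) ->
  (#|[set x in S | ev x al == t]| * #|F| = #|S|)%N.
Proof.
move=> nz_v trS; pose lev s := [set x in S | ev x al == s].
have le_lev s s' : (#|lev s| <= #|lev s'|)%N.
  pose g x := x + ((s' - s) / ev v al) *: v.
  have g_inj : injective g by move=> x y /addIr.
  rewrite -(card_imset _ g_inj); apply/subset_leq_card/subsetP=> x0 /imsetP[x].
  rewrite !inE => /andP[Sx /eqP xs] ->{x0}; rewrite trS //= evDl evZl divfK // xs.
  by rewrite addrC subrK.
rewrite -[RHS]sum1_card (partition_big (ev^~ al) predT) //=.
rewrite (eq_bigr (fun=> #|lev t|)) ?sum_nat_const ?cardT -?cardE 1?mulnC // => s _.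
by rewrite sum1dep_card; apply/eqP; rewrite eqn_leq !le_lev.
Qed.

(** A left kernel vector [v] equals [- ev v al *: b]; applying [al] forces [ev v al = 0], hence
    [v = 0]. *)
Lemma unitmx_rank1_update al (b : 'rV[F]_n) :
  1 + ev b al != 0 -> 1%:M + al *m b \in unitmx.
Proof.
move=> nz; rewrite -row_free_unit; apply/inj_row_free => v.
rewrite mulmxDr mulmx1 mulmxA [v *m al]mx11_scalar mul_scalar_mx -/(ev v al) => e.
have : ev (v + ev v al *: b) al = 0 by rewrite e /ev mul0mx mxE.
rewrite evDl evZl -{1}[ev v al]mulr1 -mulrDr => /eqP; rewrite mulf_eq0 (negPf nz) orbF.
by move/eqP=> v0; rewrite v0 scale0r addr0 in e.
Qed.

End LinearForms.

(** * Alternating maps and the slice [u = 1] *)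

Section AlternatingMaps.

Local Open Scope ring_scope.

Variables (F : finFieldType) (n w : nat).
Variables (c : 'rV[F]_n -> 'rV[F]_n -> 'rV[F]_w) (u : 'cV[F]_n).
Implicit Types (x y v : 'rV[F]_n) (al be : 'cV[F]_n).
Local Notation q := #|F|.

Hypothesis cDl : forall a x y z, c (a *: x + y) z = a *: c x z + c y z.
Hypothesis cxx : forall x, c x x = 0.
Hypothesis c_anti : forall x y, c x y = - c y x.
Hypothesis c_span : forall f : 'cV_w, (forall x y, c x y *m f = 0) -> f = 0.
(** This is what minimality of the group yields, see [exists_bad_element]; the premise says that
    [al] is not a multiple of [u]. *)
Hypothesis c_max : forall al, ~~ (al^T <= u^T)%MS ->
  exists x (f : 'cV_w), [/\ ev x al = 0, ev x u != 0 /\ f != 0,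
    forall y z, ev y al = 0 -> ev z al = 0 -> c y z *m f = 0
    & forall y, c x y *m f = 0].

Lemma alt0l y : c 0 y = 0.
Proof. by have := cDl (-1) 0 0 y; rewrite scaler0 addr0 scaleN1r addNr. Qed.

Lemma altDl x y z : c (x + y) z = c x z + c y z.
Proof. by rewrite -[x]scale1r cDl !scale1r. Qed.

Lemma altZl a x z : c (a *: x) z = a *: c x z.
Proof. by rewrite -[_ *: x]addr0 cDl alt0l addr0. Qed.

Lemma altDr x y z : c x (y + z) = c x y + c x z.
Proof. by rewrite c_anti altDl opprD -!c_anti. Qed.

Lemma altZr a x y : c x (a *: y) = a *: c x y.
Proof. by rewrite c_anti altZl -scalerN -c_anti. Qed.

(** The rank of this matrix is r(x) in the overview. *)
Definition adm x : 'M[F]_(n, w) := \matrix_i c x (delta_mx 0 i).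

Lemma admE x y : y *m adm x = c x y.
Proof.
rewrite mulmx_sum_row [in RHS](row_sum_delta y).
rewrite (big_morph (c x) (altDr x) (_ : c x 0 = 0)) ?[c x 0]c_anti ?alt0l ?oppr0 //.
by apply: eq_bigr => i _; rewrite rowK altZr.
Qed.

Lemma ev_adm x y (f : 'cV_w) : ev y (adm x *m f) = ev (c x y) f.
Proof. by rewrite /ev mulmxA admE. Qed.

Lemma rank_adm x : x != 0 -> (\rank (adm x) < n)%N.
Proof.
move=> nz_x; rewrite ltn_neqAle rank_leq_row andbT; apply: contra nz_x => fr.
by apply/eqP/(row_free_inj fr); rewrite mul0mx admE cxx.
Qed.

(** A functional on the target that kills [c] on the hyperplane [al = 0] pulls back
    to a decomposable form [al /\ be]; moreover [u], [al], [be] are independent. *)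
Lemma decomposable_form al : ~~ (al^T <= u^T)%MS ->
  exists (be : 'cV_n) (f : 'cV_w) v v',
  [/\ forall x y, ev (c x y) f = ev x al * ev y be - ev x be * ev y al,
      [/\ ev v al = 0, ev v be != 0 & ev v u = 0]
    & ev v' al != 0 /\ ev v' u = 0].
Proof.
move=> al_u; have [x [f [xal [xu nz_f] f0 fx]]] := c_max al_u.
have [z zal] : exists z, ev z al = 1.
  have [al0|] := eqVneq al 0.
    by rewrite al0 trmx0 sub0mx in al_u.
  case/cV0Pn => i ali; exists ((al i 0)^-1 *: delta_mx 0 i).
  by rewrite evZl ev_delta mulVf.
pose be := adm z *m f; have beE y : ev y be = ev (c z y) f by exact: ev_adm.
have key s t : ev (c s t) f = ev s al * ev t be - ev s be * ev t al.
  have split y : exists2 y', ev y' al = 0 & y = ev y al *: z + y'.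
    exists (y - ev y al *: z); last by rewrite addrC subrK.
    by rewrite evBl evZl zal mulr1 subrr.
  have [s' s'0 ->] := split s; have [t' t'0 ->] := split t.
  have ff y1 y2 : ev y1 al = 0 -> ev y2 al = 0 -> ev (c y1 y2) f = 0.
    by move=> a1 a2; rewrite /ev f0 // mxE.
  have fz y1 : ev (c y1 z) f = - ev (c z y1) f.
    by rewrite c_anti /ev mulNmx mxE.
  rewrite !beE !(altDl, altDr, altZl, altZr, evDl, evZl) s'0 t'0 zal cxx.
  have -> : ev (0 : 'rV_w) f = 0 by rewrite /ev mul0mx mxE.
  by rewrite fz (ff _ _ s'0 t'0); ring.
have xbe : ev x be = 0 by rewrite beE c_anti /ev mulNmx fx !mxE oppr0.
(* [x] lies in the radical of the form and off [u = 0], so adding multiples of it corrects [u]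
   without changing [al] or [be]. *)
have fix_u y : exists y', [/\ ev y' u = 0, ev y' al = ev y al & ev y' be = ev y be].
  exists (y - (ev y u / ev x u) *: x).
  by rewrite !evBl !evZl xal xbe divfK // !mulr0 subrr !subr0.
(* If [be] vanished on [al = 0], it would be a multiple of [al], and the form would be zero, against
   [c_span]. *)
have [y yal ybe] : exists2 y, ev y al = 0 & ev y be != 0.
  have [y /andP[/eqP ya yb]|none] := pickP [pred y | (ev y al == 0) && (ev y be != 0)].
    by exists y.
  case/eqP: nz_f; apply: c_span => s t; apply/matrixP=> i j; rewrite !ord1 [RHS]mxE.
  rewrite -/(ev _ _) key.
  have beal y : ev y be = ev y al * ev z be.
    have := none (y - ev y al *: z); rewrite /= !(evBl, evZl) zal mulr1 subrr eqxx /=.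
    by move/negbFE; rewrite subr_eq0 => /eqP.
  by rewrite (beal s) (beal t); ring.
have [v [vu va vb]] := fix_u y; have [v' [v'u v'a v'b]] := fix_u z.
exists be, f, v, v'; split=> //; split; rewrite ?va ?vb ?v'a ?zal ?oner_neq0 //.
Qed.


Hypothesis nz_u : u != 0.
Let X := [set x | ev x u == 1].

Lemma card_slice : (#|X| * q = q ^ n)%N.
Proof.
have [v vu] : exists v, ev v u != 0.
  by case/cV0Pn: nz_u => i ui; exists (delta_mx 0 i); rewrite ev_delta.
have -> : (q ^ n = #|[set: 'rV[F]_n]|)%N by rewrite cardsT card_mx mul1n.
rewrite -(card_level (S := setT) 1 vu) => [|x a _].
  by congr (_ * _)%N; apply: eq_card => x; rewrite !inE.
by rewrite !inE.
Qed.

(** If [f \o c = al /\ be], [al x = 0] and [be x != 0], then [al] is, up to a scalar,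
    the contraction of the form with [x], hence in the column space of [adm x]. *)
Lemma slice_count (a : 'rV[F]_n) : ~~ (a <= u^T)%MS ->
  (#|X| * q.-1 <= q ^ 2 * #|[set x in X | (a <= (adm x)^T)%MS]|)%N.
Proof.
rewrite -[a]trmxK; set al := a^T => al_u.
have [be [f [v [v' [key [va vb vu] [v'a v'u]]]]]] := decomposable_form al_u.
(* [v'] and [v] lie in [u = 0], so imposing [al = 0] and then [be = 0] divides the size by [q] each
   time; [X0 :\: X1] is the fraction (q - 1) / q^2 of the slice. *)
pose X0 := [set x in X | ev x al == 0]; pose X1 := [set x in X0 | ev x be == 0].
have c0 : (#|X0| * q = #|X|)%N.
  by apply: (card_level _ v'a) => x b; rewrite !inE evDl evZl v'u mulr0 addr0.
have c1 : (#|X1| * q = #|X0|)%N.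
  apply: (card_level _ vb) => x b; rewrite !inE !evDl !evZl vu va.
  by rewrite !mulr0 !addr0.
have sub : (#|X0 :\: X1| <= #|[set x in X | (al^T <= (adm x)^T)%MS]|)%N.
  apply/subset_leq_card/subsetP=> x; rewrite !inE.
  case/andP=> H /andP[xu /eqP xal]; rewrite xu xal eqxx /= in H *.
  apply/submxP; exists ((- (ev x be)^-1) *: f^T).
  rewrite -scalemxAl -trmx_mul -linearZ /=; congr (_^T).
  apply: ev_inj => y; rewrite evZr ev_adm key xal mul0r sub0r.
  by rewrite mulNr mulrN opprK mulKf.
apply: leq_trans (leq_mul (leqnn _) sub).
rewrite cardsDS; last by apply/subsetP=> x; rewrite inE => /andP[].
rewrite -c0 -c1; case: (q) => [|k] /=; rewrite ?muln0 //; lia.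
Qed.

(** Double counting: [q ^ \rank (adm x)] counts the functionals in the column space of [adm x].
    Among the multiples of [u] only 0 is used, once for every [x]; all other functionals fall under
    [slice_count]. *)
Lemma sum_rank_ge :
  (#|X| * (#|X| * q.-1).+1 <= q * \sum_(x in X) q ^ \rank (adm x))%N.
Proof.
have q_gt1 : (1 < q)%N := card_finNzRing_gt1 F.
have -> : (\sum_(x in X) q ^ \rank (adm x) =
           \sum_(a : 'rV[F]_n) #|[set x in X | (a <= (adm x)^T)%MS]|)%N.
  under eq_bigr => x _ do rewrite -mxrank_tr -card_rowg -sum1dep_card big_mkcond.
  rewrite exchange_big /=; apply: eq_bigr => a _.
  by rewrite -sum1dep_card -big_mkcondr; apply: eq_bigl => x.
pose B := rowg u^T.
have cB : #|B| = q.
  by rewrite card_rowg mxrank_tr -[RHS]expn1; congr (_ ^ _)%N;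
     apply/eqP; rewrite eqn_leq rank_leq_col lt0n mxrank_eq0.
have cBC : #|~: B| = (q * #|X| - q)%N.
  by rewrite cardsCs setCK card_mx mul1n cB -card_slice mulnC.
rewrite (bigID (mem B)) /= mulnDr.
have lo : (#|X| <= \sum_(i in B) #|[set x in X | (i <= (adm x)^T)%MS]|)%N.
  rewrite (bigD1 0) ?inE ?sub0mx //=; apply: leq_trans (leq_addr _ _).
  by apply/subset_leq_card/subsetP=> x Xx; rewrite inE Xx sub0mx.
have hi : (#|~: B| * (#|X| * q.-1) <=
   q ^ 2 * \sum_(i | i \notin B) #|[set x in X | (i <= (adm x)^T)%MS]|)%N.
  rewrite -sum_nat_const big_distrr /=.
  rewrite [X in (_ <= X)%N](eq_bigl (mem (~: B))) => [|a]; last by rewrite !inE.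
  by apply: leq_sum => a; rewrite !inE => nBa; apply: slice_count.
move: lo hi; rewrite cBC; set s1 := (\sum_(_ in _) _)%N; set s2 := (\sum_(_ | _) _)%N.
have X_gt0 : (0 < #|X|)%N.
  by have := card_slice; case: (#|X|) => // e; have := expn_gt0 q n; rewrite -e; lia.
clearbody s1 s2; move: (#|X|) (q) X_gt0 q_gt1 => N k N_gt0 k_gt1 lo hi.
have e : ((k * N - k) * (N * k.-1) = k * (N.-1 * (N * k.-1)))%N.
  by case: N N_gt0 {lo hi} => // N _; rewrite mulnS addKn -mulnA.
rewrite e -mulnn -mulnA (leq_pmul2l (ltnW k_gt1)) in hi.
apply: (leq_trans _ (leq_add (leq_mul (leqnn k) lo) hi)).
case: N N_gt0 {lo hi e} => // N _; case: k k_gt1 => // k _ /=; lia.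
Qed.

(** * The exterior square and commuting pairs *)

Let Pairs := [set ij : 'I_n * 'I_n | ij.1 < ij.2]%N.

Let swapK : involutive (fun ij : 'I_n * 'I_n => (ij.2, ij.1)).
Proof. by case. Qed.

Lemma card_lt_pairs : #|Pairs| = 'C(n, 2).
Proof.
rewrite -bin2_sum big_mkord -sum1dep_card.
transitivity (\sum_(j < n) \sum_(i < n | (i < j)%N) 1)%N.
  rewrite pair_big_dep /= (reindex_inj (inv_inj swapK)) /=.
  by apply: eq_bigl => -[i j].
apply: eq_bigr => j _.
by rewrite -(big_ord_widen n (fun=> 1%N)) 1?ltnW // sum1_card card_ord.
Qed.

(** Coordinates of x /\ y in the basis e_i /\ e_j, i < j, of the exterior square; [wedge_mx] is the
    linear map that [c] induces there. *)
Definition wedge x y : 'rV[F]_#|Pairs| :=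
  \row_k (x 0 (enum_val k).1 * y 0 (enum_val k).2 -
          x 0 (enum_val k).2 * y 0 (enum_val k).1).

Definition wedge_mx : 'M[F]_(#|Pairs|, w) :=
  \matrix_k c (delta_mx 0 (enum_val k).1) (delta_mx 0 (enum_val k).2).

Lemma c_wedge x y : c x y = wedge x y *m wedge_mx.
Proof.
pose t ij := (x 0 ij.1 * y 0 ij.2) *: c (delta_mx 0 ij.1) (delta_mx 0 ij.2).
have -> : c x y = \sum_ij t ij.
  rewrite -(pair_bigA _ (fun i j => t (i, j))) /=.
  rewrite {1}(row_sum_delta x) (big_morph (c^~ y) (fun a b => altDl a b y) (alt0l y)).
  apply: eq_bigr => i _; rewrite altZl -admE mulmx_sum_row scaler_sumr.
  by apply: eq_bigr => j _; rewrite rowK scalerA.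
rewrite (bigID (mem Pairs)) /= [X in _ + X](bigID (fun ij : 'I_n * 'I_n => ij.2 < ij.1)%N) /=.
rewrite [X in _ + (_ + X)]big1 ?addr0; last first.
  case=> i j; rewrite inE /= -!leqNgt andbC => /anti_leq/val_inj->.
  by rewrite /t cxx scaler0.
rewrite [X in _ + X](reindex_inj (inv_inj swapK)) /=.
rewrite [X in _ + X](eq_bigl (mem Pairs)); last first.
  by case=> i j; rewrite !inE /=; case: ltngtP.
rewrite -big_split /= big_enum_val mulmx_sum_row; apply: eq_bigr => k _.
rewrite rowK mxE /t /=; case: (enum_val k) => i j /=.
by rewrite [c (delta_mx 0 j) _]c_anti scalerN -scalerBl.
Qed.

(** Contracting x /\ y with [u] gives u(x) y - u(y) x, which is [y] here. *)
Lemma wedge_inj_r x y x' y' : ev x u = 1 -> ev y u = 0 -> ev x' u = 1 ->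
  ev y' u = 0 -> wedge x y = wedge x' y' ->
  y = y' /\ forall i j, x 0 i * y 0 j - x 0 j * y 0 i = x' 0 i * y' 0 j - x' 0 j * y' 0 i.
Proof.
move=> xu yu x'u y'u e.
have E i j : x 0 i * y 0 j - x 0 j * y 0 i = x' 0 i * y' 0 j - x' 0 j * y' 0 i.
  have lt (i' j' : 'I_n) : (i' < j')%N ->
      x 0 i' * y 0 j' - x 0 j' * y 0 i' = x' 0 i' * y' 0 j' - x' 0 j' * y' 0 i'.
    move=> ij; have Pij : (i', j') \in Pairs by rewrite inE.
    by move/rowP/(_ (enum_rank_in Pij (i', j'))): e; rewrite !mxE enum_rankK_in.
  case: (ltngtP i j) => [/lt //|/lt ji|/val_inj ->]; last by rewrite !subrr.
  by rewrite -opprB ji opprB.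
split=> //; have recover a b : ev a u = 1 -> ev b u = 0 ->
    forall j, b 0 j = \sum_i (a 0 i * b 0 j - a 0 j * b 0 i) * u i 0.
  move=> au bu j; under eq_bigr => i _ do rewrite mulrBl mulrAC -[a 0 j * _ * _]mulrA.
  rewrite sumrB -mulr_suml -mulr_sumr.
  move: au bu; rewrite /ev !mxE => -> ->; by rewrite mul1r mulr0 subr0.
apply/rowP=> j; rewrite (recover x y) // (recover x' y') //.
by apply: eq_bigr => i _; rewrite E.
Qed.

Lemma wedge_mx_full : row_full wedge_mx.
Proof.
rewrite /row_full -mxrank_tr -/(row_free _) -kermx_eq0; apply/eqP/row_matrixP=> i.
rewrite row0; apply: trmx_inj; rewrite trmx0; apply: c_span => x y.
rewrite c_wedge -mulmxA; set K := kermx _.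
have -> : wedge_mx *m (row i K)^T = (row i (K *m wedge_mx^T))^T.
  by rewrite row_mul trmx_mul trmxK.
by rewrite mulmx_ker row0 trmx0 mulmx0.
Qed.

Lemma leq_dim_wedge : (w <= 'C(n, 2))%N.
Proof. by rewrite -card_lt_pairs -(eqP wedge_mx_full) rank_leq_row. Qed.

(** The map [(x, y) |-> x /\ y], for [u x = 1], [u y = 0], [y != 0] and [c x y = 0], lands
    in the nonzero part of the kernel of the map induced by [c] on the exterior square.
    It is at most [q]-to-one: contracting with [u] recovers [y], and then [x] is
    determined modulo [y]. *)
Lemma sum_corank_le :
  (\sum_(x in X) (q ^ (n.-1 - \rank (adm x))).-1 <= q * (q ^ ('C(n, 2) - w)).-1)%N.
Proof.
pose C x := [set y | (y *m adm x == 0) && (ev y u == 0)].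
(* [x] itself lies in the kernel of [adm x] and [u x = 1], so the condition [u y = 0] cuts this
   kernel by a factor [q]. *)
have cardC x : x \in X -> #|C x| = (q ^ (n.-1 - \rank (adm x)))%N.
  rewrite inE => /eqP xu.
  have nz_x : x != 0.
    by apply/eqP=> x0; move/eqP: xu; rewrite x0 /ev mul0mx mxE eq_sym oner_eq0.
  have q_gt0 : (0 < q)%N := ltnW (card_finNzRing_gt1 F).
  have rn := rank_adm nz_x.
  apply/eqP; rewrite -(eqn_pmul2r q_gt0) -expnSr -subSn; last by lia.
  rewrite prednK; last by lia.
  rewrite -mxrank_ker -card_rowg -(card_level (S := rowg (kermx (adm x))) 0 (v := x) (al := u)).
  - apply/eqP; congr (_ * _)%N; apply: eq_card => y.
    by rewrite !inE (sameP sub_kermxP eqP).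
  - by rewrite xu oner_neq0.
  move=> y a; rewrite !inE => ky; rewrite addmx_sub // scalemx_sub //.
  by apply/sub_kermxP; rewrite admE cxx.
pose C0 x := C x :\ 0; pose K0 := rowg (kermx wedge_mx) :\ 0.
have -> : (\sum_(x in X) (q ^ (n.-1 - \rank (adm x))).-1 =
           #|[set xy | (xy.1 \in X) && (xy.2 \in C0 xy.1)]|)%N.
  rewrite -sum1dep_card -(pair_big_dep (mem X) (fun x y => y \in C0 x) (fun _ _ => 1%N)) /=.
  apply: eq_bigr => x Xx; rewrite sum1_card -(cardC x Xx).
  by rewrite (cardsD1 0 (C x)) inE mul0mx /ev mul0mx mxE !eqxx.
(* The second component, a coordinate of [x] where [y] is nonzero, singles out [x] modulo multiples
   of [y]. The default 0 would need [y = 0], which is excluded. *)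
pose g (xy : 'rV[F]_n * 'rV[F]_n) :=
  (wedge xy.1 xy.2, if [pick j | xy.2 0 j != 0] is Some j then xy.1 0 j else 0).
rewrite -(card_in_imset (f := g)); last first.
  case=> x y [x' y']; rewrite !inE /=.
  case/and3P=> /eqP xu nz_y /andP[_ /eqP yu]; case/and3P=> /eqP x'u _ /andP[_ /eqP y'u].
  case=> /wedge_inj_r[] // yy' E e; move: e E; rewrite -{y' y'u}yy' => e E; congr (_, _).
  case: pickP e => [j yj e|y0]; last first.
    by case/eqP: nz_y; apply/rowP=> j; apply/eqP; rewrite mxE; apply/negPn; rewrite y0.
  apply/rowP=> i; apply: (mulIf yj); have := E i j; rewrite e.
  by move/eqP; rewrite (inj_eq (addIr _)) => /eqP.
have -> : (q * (q ^ ('C(n, 2) - w)).-1 = #|setX K0 [set: F]|)%N.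
  rewrite cardsX cardsT mulnC; congr (_ * _)%N.
  have <- : #|rowg (kermx wedge_mx)| = (q ^ ('C(n, 2) - w))%N.
    by rewrite card_rowg mxrank_ker (eqP wedge_mx_full) -card_lt_pairs.
  by rewrite (cardsD1 0 (rowg _)) inE sub0mx.
apply/subset_leq_card/subsetP=> z /imsetP[[x y]]; rewrite !inE /=.
case/and3P=> /eqP xu nz_y /andP[cxy /eqP yu] ->{z}; rewrite /= andbT.
apply/andP; split; last by apply/sub_kermxP; rewrite -c_wedge -admE; apply/eqP.
apply: contra nz_y => /eqP w0.
have [] := @wedge_inj_r x y x 0; rewrite ?w0 ?yu //; first by rewrite /ev mul0mx mxE.
  by apply/rowP=> k; rewrite !mxE !mulr0 subrr.
by move=> ->.
Qed.

(** * Bases inside the slice *)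

Let slice_basis B := (B \in unitmx) && [forall i, ev (row i B) u == 1].

Lemma slice_basis_exists : exists B : 'M[F]_n, slice_basis B.
Proof.
case/cV0Pn: nz_u => i0 ui; pose b : 'rV[F]_n := (u i0 0)^-1 *: delta_mx 0 i0.
(* Row i is e_i + (1 - u(e_i)) b with u(b) = 1. *)
exists (1%:M + (const_mx 1 - u) *m b); apply/andP; split.
  apply: unitmx_rank1_update; rewrite /ev mulmxBr -!/(ev _ _) mxE [X in _ + (_ + X)]mxE.
  by rewrite -!/(ev _ _) !evZl !ev_delta mulVf // mxE mulr1 addrCA subrr addr0 invr_eq0.
apply/forallP=> i; rewrite linearD /= row1 row_mul evDl ev_delta.
have bu : b *m u = 1%:M.
  by rewrite [LHS]mx11_scalar -/(ev _ _) evZl ev_delta mulVf.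
rewrite /ev -mulmxA bu mulmx1 !mxE; apply/eqP; ring.
Qed.

(** Exchange: take a basis inside the slice [u = 1] of maximal total rank. *)
Lemma max_slice_basis : exists B : 'M[F]_n, slice_basis B /\
  forall x i, x \in X -> (x *m invmx B) 0 i != 0 ->
    (\rank (adm x) <= \rank (adm (row i B)))%N.
Proof.
have [B0 sB0] := slice_basis_exists.
pose wt (B : 'M[F]_n) := (\sum_i \rank (adm (row i B)))%N.
case: (@arg_maxnP _ B0 slice_basis wt sB0) => B /andP[uB /forallP Bu] maxB.
exists B; split=> [|x i Xx xi]; first by rewrite /slice_basis uB; apply/forallP.
pose a := x *m invmx B.
(* [B'] is [B] with row [i] replaced by [x]; it stays invertible because coordinate [i] of [x] is
   nonzero. *)
pose B' := (1%:M + delta_mx i 0 *m (a - delta_mx 0 i)) *m B.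
have rowB' j : row j B' = if j == i then x else row j B.
  rewrite row_mul linearD /= row1 row_mul mulmxDl -rowE.
  have -> : row j (delta_mx i 0 : 'cV[F]_n) = (j == i)%:R%:M.
    by apply/matrixP=> s t; rewrite !ord1 !mxE eqxx andbT mulr1n.
  rewrite mul_scalar_mx -scalemxAl; case: eqP => [->|_].
    by rewrite scale1r mulmxBl -rowE mulmxKV // addrC subrK.
  by rewrite scale0r addr0.
have sB' : slice_basis B'.
  apply/andP; split.
    rewrite unitmx_mul uB andbT; apply: unitmx_rank1_update.
    have ea : ev a (delta_mx i 0) = a 0 i by rewrite /ev -colE mxE.
    by rewrite evBl ea ev_delta [delta_mx _ _ _ _]mxE !eqxx addrC subrK.
  by apply/forallP=> j; rewrite rowB'; case: (j == i); rewrite ?Bu //; rewrite inE in Xx.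
have {maxB} : (wt B' <= wt B)%N := maxB _ sB'.
rewrite /wt [X in (X <= _)%N](bigD1 i) //= [X in (_ <= X)%N](bigD1 i) //=.
rewrite rowB' eqxx (eq_bigr (fun j => \rank (adm (row j B)))) ?leq_add2r // => j ji.
by rewrite rowB' (negPf ji).
Qed.

Let vanish (B : 'M[F]_n) (T : {set 'I_n}) :=
  [set x in X | [forall i in T, (x *m invmx B) 0 i == 0]].

(** Each condition divides the size by [q]: translation along row [i] minus row [z] keeps [u] and,
    as [z] is outside [T], the other coordinates in [T]. *)
Lemma card_slice_vanish (B : 'M[F]_n) (T : {set 'I_n}) z : slice_basis B -> z \notin T ->
  (#|vanish B T| * q ^ #|T| = #|X|)%N.
Proof.
case/andP=> uB /forallP Bu; move: {2}#|T| (erefl #|T|) => m.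
elim: m T => [|m IH] T cT zT.
  move/eqP: (cT); rewrite cards_eq0 => /eqP T0; rewrite cT muln1.
  apply: eq_card => x; rewrite !inE T0; apply: andb_idr => _.
  by apply/forall_inP=> i; rewrite inE.
have [i Ti] : exists i, i \in T by apply/card_gt0P; rewrite cT.
have cT' : #|T :\ i| = m by move: cT; rewrite (cardsD1 i) Ti => -[].
have zT' : z \notin T :\ i by rewrite inE negb_and zT orbT.
rewrite -(IH _ cT' zT') cT cT' expnS mulnA; congr (_ * _)%N.
pose v := row i B - row z B.
have coord j k : (row j B *m invmx B) 0 k = (j == k)%:R.
  by rewrite -row_mul mulmxV // !mxE.
have evc x j : ev x (col j (invmx B)) = (x *m invmx B) 0 j.
  by rewrite /ev colE mulmxA -colE mxE.
have zi : z != i by apply: contraNneq zT => ->.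
rewrite -(@card_level _ _ (vanish B (T :\ i)) v (col i (invmx B)) 0).
- congr (_ * _)%N; apply: eq_card => x; rewrite !inE evc -andbA; congr andb.
  apply/forall_inP/andP=> [H|[/forall_inP H xi] j Tj].
    split; last exact: H.
    by apply/forall_inP=> j; rewrite !inE => /andP[_ Tj]; apply: H.
  by have [-> //|ji] := eqVneq j i; apply: H; rewrite !inE ji.
- by rewrite evBl !evc !coord eqxx (negPf zi) subr0 oner_neq0.
move=> x a; rewrite !inE => /andP[xu /forall_inP H]; apply/andP; split.
  by rewrite evDl evZl evBl (eqP (Bu i)) (eqP (Bu z)) subrr mulr0 addr0.
apply/forall_inP=> j Tj; have := Tj; rewrite !inE => /andP[ji Tj'].
have zj : z != j by apply: contraNneq zT => ->.
rewrite -evc evDl evZl evBl !evc !coord (eqP (H j Tj)) [i == j]eq_sym (negPf ji) (negPf zj).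
by rewrite subrr mulr0 addr0.
Qed.

(** By exchange, a row of corank k in the basis of maximal total rank forces corank at least k on
    every slice vector with a nonzero coordinate there. This is weighed against the two counting
    bounds. *)
Lemma good_slice_basis : exists B : 'M[F]_n,
  [/\ B \in unitmx, forall i, ev (row i B) u = 1,
      exists i, \rank (adm (row i B)) = n.-1
    & (w + \sum_i (n.-1 - \rank (adm (row i B))) <= 'C(n, 2))%N].
Proof.
have q_gt1 : (1 < q)%N := card_finNzRing_gt1 F.
have n_gt0 : (0 < n)%N by case/cV0Pn: nz_u => i _; apply: leq_trans (ltn_ord i).
have [B [sB exch]] := max_slice_basis; have /andP[uB /forallP Bu] := sB.
have Xnz x : x \in X -> x != 0.
  by rewrite inE; apply: contraTneq => ->; rewrite /ev mul0mx mxE eq_sym oner_eq0.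
have rle x : x \in X -> (\rank (adm x) <= n.-1)%N.
  by move=> Xx; rewrite -ltnS prednK // rank_adm ?Xnz.
have cX : #|X| = (q ^ n.-1)%N.
  apply/eqP; rewrite -(eqn_pmul2r (ltnW q_gt1)) card_slice.
  by rewrite -{1}(prednK n_gt0) expnSr.
have X_gt0 : (0 < #|X|)%N by rewrite cX expn_gt0 ltnW.
have XB i : row i B \in X by rewrite inE.
(* Otherwise all ranks on the slice are at most n - 2, too small for [sum_rank_ge]. *)
have [i0 ri0] : exists i, \rank (adm (row i B)) = n.-1.
  have [i /eqP ri|none] := pickP [pred i | \rank (adm (row i B)) == n.-1]; first by exists i.
  have : (q * \sum_(x in X) q ^ \rank (adm x) <= #|X| * #|X|)%N.
    rewrite big_distrr /= -sum_nat_const; apply: leq_sum => x Xx.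
    rewrite -expnS cX leq_exp2l //.
    have : x *m invmx B != 0.
      by apply: contra (Xnz x Xx) => /eqP e; rewrite -(mulmxKV uB x) e mul0mx.
    case/rV0Pn=> i xi; apply: leq_ltn_trans (exch x i Xx xi) _.
    by rewrite ltn_neqAle (rle _ (XB i)) andbT; apply/negbT/none.
  move/(leq_trans sum_rank_ge); rewrite leq_pmul2l // => /(leq_trans _) H.
  have : (#|X| < #|X|)%N by apply: H; rewrite ltnS leq_pmulr // -ltnS prednK // ltnW.
  by rewrite ltnn.
pose k x := (n.-1 - \rank (adm x))%N.
have kx x i : x \in X -> (x *m invmx B) 0 i != 0 -> (k (row i B) <= k x)%N.
  by move=> Xx xi; rewrite leq_sub2l ?exch.
have cV := card_slice_vanish sB.
have notV x T : x \in X -> x \notin vanish B T -> exists2 i, i \in T & (x *m invmx B) 0 i != 0.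
  move=> Xx; rewrite inE Xx negb_forall => /existsP[i].
  by rewrite negb_imply => /andP[]; exists i.
have sumV T a : (\sum_(x in X) (if x \in vanish B T then a else 0) = #|vanish B T| * a)%N.
  rewrite -big_mkcondr -sum_nat_const; apply: eq_bigl => x.
  by rewrite andb_idl // inE => /andP[].
(* With two rows of corank at least 2, only the fraction 1 / q^2 of the slice where both coordinates
   vanish could have rank above n - 3, again against [sum_rank_ge]. *)
have k2 i j : (1 < k (row i B))%N -> (1 < k (row j B))%N -> i = j.
  move=> ki kj; apply/eqP/negPn/negP=> ij.
  have zT : i0 \notin [set i; j].
    rewrite !inE negb_or; apply/andP; split.
      by apply: contraTneq ki => <-; rewrite /k ri0 subnn.
    by apply: contraTneq kj => <-; rewrite /k ri0 subnn.
  have := cV _ _ zT; rewrite cards2 ij => cV2.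
  have : (q ^ 2 * \sum_(x in X) q ^ \rank (adm x) <=
          #|X| * #|X| + #|vanish B [set i; j]| * (q ^ 2 * #|X|))%N.
    rewrite -sumV -sum_nat_const -big_split big_distrr /=; apply: leq_sum => x Xx.
    case: ifPn => [_|/(notV x _ Xx)[l]].
      by apply: leq_trans (leq_addl _ _); rewrite leq_mul2l cX leq_exp2l // rle ?orbT.
    rewrite addn0 -expnD cX leq_exp2l // !inE => lij /(kx x _ Xx).
    have k2l : (1 < k (row l B))%N by case/orP: lij => /eqP->.
    by move/(leq_trans k2l); rewrite /k; lia.
  have A := sum_rank_ge; rewrite [X in (_ <= _ + X)%N]mulnA cV2 -mulnn -mulnA; move/(leq_trans (leq_mul (leqnn q) A)).
  move: (#|X|) X_gt0 (q) q_gt1 => N N_gt0 [//|h] h_gt0 /=.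
  rewrite -mulnDr mulnCA leq_pmul2l //; nia.
exists B; split=> //; first by move=> i; apply/eqP.
  by exists i0.
pose Z := [set i | k (row i B) == 0%N].
have [l0 lZ0|all0] := pickP [pred i | i \notin Z]; last first.
  rewrite big1 ?addn0 ?leq_dim_wedge // => i _.
  by have /negbFE := all0 i; rewrite inE => /eqP.
have [l lZ maxl] : exists2 l, l \notin Z & forall i, (k (row i B) <= k (row l B))%N.
  have [//|l _ maxl] := @arg_maxnP _ l0 predT (fun i => k (row i B)).
  exists l => [|i]; last exact: maxl.
  by move: lZ0; rewrite !inE /= -!lt0n => /leq_trans; apply; apply: maxl.
have i0Z : i0 \in Z by rewrite inE /k ri0 subnn.
have i0l : i0 \notin [set l] by rewrite inE; apply: contraNneq lZ => <-.
have i0ZC : i0 \notin ~: Z by rewrite inE negbK.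
have c1 := cV _ _ i0l; have cm := cV _ _ i0ZC; rewrite cards1 expn1 in c1.
set ka := k (row l B) in maxl.
have ka_gt0 : (0 < ka)%N by rewrite lt0n; rewrite inE in lZ.
have sumk : (\sum_i k (row i B) <= ka + #|~: Z :\ l|)%N.
  rewrite (bigD1 l) //= leq_add2l -sum1_card big_mkcond [X in (_ <= X)%N]big_mkcond /=.
  apply: leq_sum => i _; rewrite !inE; case: eqVneq => //= il.
  have [->//|ki] := eqVneq; rewrite leqNgt; apply: contra il => ki1.
  by apply/eqP/k2 => //; apply: leq_trans ki1 (maxl i).
have altZl : #|~: Z| = #|~: Z :\ l|.+1 by rewrite (cardsD1 l (~: Z)) inE lZ.
set e := #|_ :\ l| in sumk altZl.
rewrite -leq_subRL ?leq_dim_wedge //; apply: leq_trans sumk _.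
rewrite leqNgt; apply/negP=> small.
(* The slice splits in three: corank at least [ka] where coordinate [l] is nonzero, at least 1 where
   it vanishes but another coordinate outside [Z] does not, and the trivial bound 0 elsewhere. *)
have low : (#|X| * (q ^ ka).-1 <= q * (q ^ ('C(n, 2) - w)).-1 +
   #|vanish B [set l]| * ((q ^ ka).-1 - q.-1) + #|vanish B (~: Z)| * q.-1)%N.
  apply: leq_trans (leq_add (leq_add sum_corank_le (leqnn _)) (leqnn _)).
  rewrite -!sumV -sum_nat_const -!big_split /=; apply: leq_sum => x Xx.
  have pow a b : (a <= b)%N -> ((q ^ a).-1 <= (q ^ b).-1)%N.
    by move=> ab; rewrite -!subn1 leq_sub2r // leq_exp2l.
  have q1 : (q.-1 <= (q ^ ka).-1)%N by rewrite -[X in (X.-1 <= _)%N]expn1 pow.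
  case: ifPn => [_|/(notV x _ Xx)[j]]; last first.
    rewrite inE => /eqP-> /(kx x _ Xx)/pow H.
    by rewrite addn0; apply: leq_trans H (leq_addr _ _).
  case: ifPn => [_|/(notV x _ Xx)[j]]; first by rewrite -addnA subnK ?leq_addl.
  rewrite !inE -lt0n => kj /(kx x _ Xx)/(leq_trans kj)/pow; rewrite expn1 => H.
  by rewrite addn0 -{1}(subnKC q1) leq_add2r.
have small' : (q * q ^ ('C(n, 2) - w) <= q ^ ka * q ^ e)%N.
  by rewrite -expnS -expnD leq_exp2l.
have P_gt0 : (0 < q ^ ('C(n, 2) - w))%N by rewrite expn_gt0 ltnW.
have E_gt0 : (0 < q ^ e)%N by rewrite expn_gt0 ltnW.
have K_ge : (q <= q ^ ka)%N by rewrite -{1}(expn1 q) leq_exp2l.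
have t_gt0 : (0 < #|vanish B (~: Z)|)%N by move: X_gt0; rewrite -cm; case: #|vanish _ _|.
rewrite -cm altZl expnSr mulnA in c1 low.
move/eqP: c1; rewrite eqn_pmul2r ?(ltnW q_gt1) // => /eqP c1; rewrite c1 in low.
move: (q) (#|vanish B (~: Z)|) (q ^ e)%N (q ^ ka)%N (q ^ (_ - w))%N
  t_gt0 E_gt0 K_ge P_gt0 q_gt1 small' low => [//|h] t E K P t_gt0 E_gt0 K_ge P_gt0 h_gt0.
case: K K_ge => // K K_ge; case: P P_gt0 => // P _ /=.
move=> small' low.
(* With a = t h and Y = E (K + 1) this reads (a - 1)(Y - 1) + h <= 0, impossible for positive a, Y
   and h. *)
have {}low : (t * h * (E * K.+1) + h.+1 <= E * K.+1 + t * h)%N.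
  have e1 : (t * E * h.+1 * K = t * E * K * h + t * E * K)%N by lia.
  have e2 : (t * E * K = t * E * (K - h) + t * E * h)%N.
    by rewrite -mulnDr subnK.
  lia.
have : (0 < t * h)%N by rewrite muln_gt0 t_gt0.
have : (0 < E * K.+1)%N by rewrite muln_gt0 E_gt0.
move: (t * h)%N (E * K.+1)%N low => a Y; nia.
Qed.

End AlternatingMaps.

(** * Commutators in finite p-groups *)

Lemma card_class_index (gT : finGroupType) (G L : {group gT}) x :
  L \subset G -> 'C_G[x] \subset L -> #|x ^: G| = (#|G : L| * #|x ^: L|)%N.
Proof.
move=> sLG sCL; rewrite -!index_cent1 -(Lagrange_index sLG sCL); congr (_ * #|_ : _|)%N.
by apply/eqP; rewrite eqEsubset subsetI sCL subsetIr setSI.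
Qed.

(** * Commutators with an abelian normal subgroup *)

Section AbelianNormal.

Variables (gT : finGroupType) (A P : {group gT}).
Hypotheses (cAA : abelian A) (nsAP : A <| P).

(** For fixed [x], a |-> [a, x] is a homomorphism on the abelian group [A], so its image is a
    subgroup, as large as the [A]-class of [x]; [R] is the product of these images. *)
Lemma abelian_comm_cover (s : seq gT) : {subset s <= P} ->
  exists R : {group gT}, [/\ R \subset A, (#|R| <= \prod_(x <- s) #|x ^: A|)%N
    & forall x a, x \in s -> a \in A -> [~ a, x] \in R].
Proof.
have nAP := normal_norm nsAP.
elim: s => [|x s IH] sP; first by exists 1%G; rewrite sub1G cards1 big_nil.
have [|R [sRA cR covR]] := IH; first by move=> y sy; apply: sP; rewrite inE sy orbT.
have Px : x \in P by apply: sP; rewrite inE eqxx.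
have Acx a : a \in A -> [~ a, x] \in A.
  by move=> Aa; rewrite commgEl groupM ?groupV // memJ_norm ?(subsetP nAP).
pose Sx := [set [~ a, x] | a in A].
have gS : group_set Sx.
  apply/group_setP; split=> [|_ _ /imsetP[a Aa ->] /imsetP[b Ab ->]].
    by apply/imsetP; exists 1; rewrite ?group1 ?comm1g.
  apply/imsetP; exists (a * b); first by rewrite groupM.
  by rewrite commMgJ conjgE [_ * b](centsP cAA) ?Acx // mulKg.
have sSA : Sx \subset A by apply/subsetP=> _ /imsetP[a Aa ->]; apply: Acx.
have cS : (#|Sx| <= #|x ^: A|)%N.
  have -> : Sx = [set y^-1 * x | y in x ^: A].
    apply/setP=> z; apply/imsetP/imsetP=> [[a Aa ->]|[_ /imsetP[a Aa ->] ->]].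
      by exists (x ^ a); rewrite ?memJ_class //= commgEr conjVg.
    by exists a => //; rewrite commgEr conjVg.
  exact: leq_imset_card.
exists (Group gS <*> R)%G; split; first by rewrite join_subG sSA.
  rewrite big_cons; apply: leq_trans (leq_mul cS cR).
  have cj : Group gS <*> R = Group gS * R.
    by apply: cent_joinEl; apply: subset_trans sSA (subset_trans cAA (centS sRA)).
  have -> : #|(Group gS <*> R)%G| = #|Group gS * R| by rewrite -cj.
  by rewrite (mul_cardG (Group gS) R : (#|Sx| * #|R| = _)%N) leq_pmulr //; apply: cardG_gt0.
move=> y a; rewrite inE => /predU1P[->|sy] Aa.
  by rewrite (subsetP (joing_subl _ _)) //; apply/imsetP; exists a.
by rewrite (subsetP (joing_subr _ _)) // covR.
Qed.

(** The [g] in [P] with all [a, g] in [R] form a group, since [a, gh] = [a, h] [a, g] [[a, g], h]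
    and [R] lies in [A]; it contains [A] and [s], hence [P]. *)
Lemma card_comm_abelian_normal (s : seq gT) : {subset s <= P} ->
  P \subset <<A :|: [set x in s]>> -> (#|[~: A, P]| <= \prod_(x <- s) #|x ^: A|)%N.
Proof.
move=> sP genP; have nAP := normal_norm nsAP.
have [R [sRA cR covR]] := abelian_comm_cover sP.
pose S := [set g in P | [forall a in A, [~ a, g] \in R]].
have gS : group_set S.
  apply/group_setP; split=> [|g h].
    by rewrite inE group1; apply/forall_inP=> a Aa; rewrite commg1 group1.
  rewrite !inE => /andP[Pg /forall_inP Rg] /andP[Ph /forall_inP Rh].
  rewrite groupM //; apply/forall_inP=> a Aa; rewrite commgMJ groupM ?Rh //.
  have Aag : [~ a, g] \in A by apply: (subsetP sRA); apply: Rg.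
  by rewrite conjg_mulR groupM ?Rg ?Rh.
have sPS : P \subset Group gS.
  apply: subset_trans genP _; rewrite gen_subG subUset; apply/andP; split.
    apply/subsetP=> b Ab; rewrite inE (subsetP (normal_sub nsAP)) //.
    apply/forall_inP=> a Aa; rewrite (_ : [~ a, b] = 1) ?group1 //.
    by apply/eqP/commgP; apply: (centsP cAA).
  by apply/subsetP=> x; rewrite !inE => sx; rewrite sP //; apply/forall_inP=> a Aa; apply: covR.
apply: leq_trans cR; apply: subset_leq_card; rewrite gen_subG.
apply/subsetP=> _ /imset2P[a g Aa Pg ->].
by have := subsetP sPS g Pg; rewrite inE => /andP[_ /forall_inP]; apply.
Qed.

(** Modulo [A, P] the subgroup [A] is central, and a central subgroup and one element generate an
    abelian group. *)
Lemma der1_abelian_cyclic_ext y : y \in P -> P \subset <<y |: A>> -> P^`(1) \subset [~: A, P].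
Proof.
move=> Py genP; have nRP : P \subset 'N([~: A, P]) by rewrite commg_normr.
rewrite -quotient_cents2 //.
have cAP : A / [~: A, P] \subset 'C(P / [~: A, P]).
  by rewrite quotient_cents2 // (subset_trans (normal_sub nsAP)).
have : P / [~: A, P] \subset <<coset _ y |: A / [~: A, P]>>.
  apply: subset_trans (quotientS _ genP) _; rewrite quotient_gen; last first.
    by rewrite subUset sub1set (subsetP nRP) // (subset_trans (normal_sub nsAP)).
  by rewrite gen_subG quotientU quotient_set1 ?(subsetP nRP) // subset_gen.
move=> genQ; have sAP := normal_sub nsAP.
have ySP : coset [~: A, P] y \in P / [~: A, P] by rewrite mem_quotient.
rewrite -/(abelian _); apply: abelianS genQ _; rewrite abelian_gen /abelian.
rewrite subUset sub1set; apply/andP; split.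
  rewrite centU inE cent_set1 cent1id /=.
  by rewrite (subsetP _ _ ySP) // centsC.
by rewrite centU subsetI; apply/andP; split; apply: subset_trans cAP (centS _);
  rewrite ?sub1set ?quotientS.
Qed.

End AbelianNormal.

(** In G / H' the image of [H] is abelian and normal, so the two previous lemmas bound (G / H')' by
    the class of [y] alone. *)
Lemma card_der1_cyclic_ext (gT : finGroupType) (G H : {group gT}) y :
  H <| G -> y \in G -> G \subset <<y |: H>> -> (#|G^`(1)| <= #|H^`(1)| * #|y ^: G|)%N.
Proof.
move=> nsHG Gy genG; have [sHG nHG] := andP nsHG.
have nH'G : G \subset 'N(H^`(1)) := gFnorm_trans _ nHG.
have nsH'G : H^`(1) <| G by rewrite /normal (subset_trans (der_sub 1 H)).
have sH'G' : H^`(1) \subset G^`(1) by rewrite dergS.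
pose Q := G / H^`(1); pose A := H / H^`(1).
have nsA : A <| Q by rewrite quotient_normal.
have cA : abelian A := sub_der1_abelian (subxx _).
have genQ : Q \subset <<coset _ y |: A>>.
  apply: subset_trans (quotientS _ genG) _; rewrite quotient_gen; last first.
    by rewrite subUset sub1set (subsetP nH'G) // (subset_trans sHG).
  by rewrite gen_subG quotientU quotient_set1 ?(subsetP nH'G) // subset_gen.
have Qy : coset H^`(1) y \in Q by rewrite mem_quotient.
have cQ : (#|Q^`(1)| <= #|y ^: G|)%N.
  apply: leq_trans (subset_leq_card (der1_abelian_cyclic_ext nsA Qy genQ)) _.
  have := @card_comm_abelian_normal _ _ _ cA nsA [:: coset _ y].
  rewrite big_seq1 => /(_ _ _)/leq_trans -> //.
  - by move=> z; rewrite inE => /eqP->.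
  - by rewrite (_ : _ :|: _ = coset H^`(1) y |: A) // setUC; congr (_ :|: _); apply/setP=> z; rewrite !inE.
  have sub : coset H^`(1) y ^: A \subset coset H^`(1) @: (y ^: G).
    apply/subsetP=> _ /imsetP[_ /morphimP[h Nh Hh ->] ->].
    have Gh := subsetP sHG h Hh.
    by rewrite -morphJ ?(subsetP nH'G) //; apply/imset_f/memJ_class.
  exact: leq_trans (subset_leq_card sub) (leq_imset_card _ _).
rewrite -(Lagrange sH'G') leq_mul2l -card_quotient ?(subset_trans (der_sub 1 G)) //.
by rewrite quotient_der // cQ orbT.
Qed.

(** * The Frattini subgroup and commutators *)

Section FrattiniCommutator.

Variables (gT : finGroupType) (p : nat) (G : {group gT}).
Hypotheses (p_pr : prime p) (pG : p.-group G).
Local Notation Phi := 'Phi(G).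
Local Notation D := [~: Phi, G].

Lemma expg_Phi x : x \in G -> x ^+ p \in Phi.
Proof.
move=> Gx; have /abelemP[//|_ xp] := Phi_quotient_abelem pG.
have nPx : x \in 'N(Phi) := subsetP (gFnorm _ G) x Gx.
rewrite coset_idr ?groupX // morphX //; exact/xp/mem_quotient.
Qed.

Lemma der1_sub_Phi : G^`(1) \subset Phi.
Proof. by rewrite (Phi_joing pG) joing_subl. Qed.

Lemma comm_Phi_norm : G \subset 'N(D).
Proof. exact: commg_normr. Qed.

Lemma comm_Phi_sub_der1 : D \subset G^`(1).
Proof. by rewrite commSg ?Phi_sub. Qed.

Lemma der1_comm_sub : [~: G^`(1), G] \subset D.
Proof. by rewrite commSg ?der1_sub_Phi. Qed.

(** Modulo [D] the group G' is central, so [x, y]^p = [x^p, y], which is trivial there because x^p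
    lies in Phi(G). *)
Lemma der1_comm_Phi_abelem : p.-abelem (G^`(1) / D).
Proof.
have nD := comm_Phi_norm.
have cW : abelian (G^`(1) / D).
  rewrite /abelian quotient_cents2 ?(subset_trans (der_sub 1 G)) //.
  by rewrite (subset_trans _ der1_comm_sub) // commgS ?der_sub.
rewrite abelemE // cW /=; apply/exponentP.
have sub : G^`(1) / D \subset Group (group_Ldiv p cW).
  rewrite quotient_gen; last first.
    by apply: subset_trans (subset_gen _) (subset_trans (der_sub 1 G) nD).
  rewrite gen_subG; apply/subsetP=> _ /morphimP[_ _ /imset2P[x y Gx Gy ->] ->].
  have Nx := subsetP nD x Gx; have Ny := subsetP nD y Gy.
  have Cxy : [~ x, y] \in G^`(1) by rewrite mem_commg.
  rewrite !inE /= mem_quotient //= morphR // -commXg.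
    rewrite -morphX // -morphR ?groupX //= coset_id ?mem_commg ?expg_Phi //.
  apply/commgP; rewrite -morphR // -morphR ?groupR //= coset_id //.
  apply: (subsetP der1_comm_sub).
  by rewrite -invg_comm groupV mem_commg.
by move=> x /(subsetP sub); rewrite !inE => /andP[_ /eqP].
Qed.

(** Phi(G) is generated by G' and the p-th powers, and modulo [G', G] the commutator [x^p, y] is
    [x, y]^p, an element of Phi(G'). *)
Lemma comm_Phi_sub : D \subset 'Phi(G^`(1)) <*> [~: G^`(1), G].
Proof.
set L := _ <*> _.
have nLG : G \subset 'N(L) by rewrite normsY ?commg_normr // gFnorm_trans // gFnorm.
have nLP : Phi \subset 'N(L) := subset_trans (Phi_sub G) nLG.
have nLG' : G^`(1) \subset 'N(L) := subset_trans (der_sub 1 G) nLG.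
rewrite -quotient_cents2 // sub_morphim_pre // (Phi_joing pG) join_subG; apply/andP; split.
  by rewrite -sub_morphim_pre // quotient_cents2 ?joing_subr.
rewrite (MhoE 1 pG) gen_subG; apply/subsetP=> _ /imsetP[x Gx ->].
have Nx := subsetP nLG x Gx; rewrite expn1 mem_morphpre ?groupX //.
apply/centP=> _ /morphimP[y Ny Gy ->]; apply/commgP; rewrite morphX // commXg.
  rewrite -morphR // -morphX ?groupR //= coset_id //.
  apply: (subsetP (joing_subl _ _)); rewrite (Phi_joing (pgroupS (der_sub 1 G) pG)).
  apply: (subsetP (joing_subr _ _)); rewrite (MhoE 1 (pgroupS (der_sub 1 G) pG)).
  by apply/mem_gen/imsetP; exists [~ x, y]; rewrite ?expn1 ?mem_commg.
apply/commgP; rewrite -morphR // -morphR ?groupR //= coset_id //.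
by apply: (subsetP (joing_subr _ _)); rewrite -invg_comm groupV mem_commg ?mem_commg.
Qed.

(** [comm_Phi_sub] puts [D] in Phi(G') [G', G]. The factor Phi(G') consists of nongenerators of G',
    and [G', G] drops out because G / N is nilpotent. *)
Lemma der1_sub_mul_comm_Phi (N : {group gT}) :
  N <| G -> N \subset G^`(1) -> G^`(1) \subset N <*> D -> G^`(1) \subset N.
Proof.
move=> nsNG sNG' sG'ND; have [sNG nNG] := andP nsNG.
have e : 'Phi(G^`(1)) <*> (N <*> [~: G^`(1), G]) = G^`(1).
  apply/eqP; rewrite eqEsubset !join_subG Phi_sub sNG' commg_subl gFnorm /=.
  apply: subset_trans sG'ND _; rewrite join_subG; apply/andP; split.
    exact: subset_trans (joing_subl _ _) (joing_subr _ _).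
  apply: subset_trans comm_Phi_sub _; rewrite join_subG joing_subl /=.
  exact: subset_trans (joing_subr _ _) (joing_subr _ _).
move/Phi_nongen: e; rewrite genGid => e.
rewrite -quotient_sub1; last by rewrite (subset_trans (der_sub 1 G)).
have nilQ : nilpotent (G / N) by rewrite quotient_nil // (pgroup_nil pG).
apply/trivgP/eqP/negPn/negP=> ntQ.
have nQ : G / N \subset 'N_(G / N)(G^`(1) / N).
  by rewrite subsetI subxx quotient_norms // gFnorm.
have := nil_comm_properl nilQ (quotientS N (der_sub 1 G)) ntQ nQ.
rewrite -quotientR ?(subset_trans (der_sub 1 G)) // properE => /andP[_ /negP[]].
have nNG' : G^`(1) \subset 'N(N) := subset_trans (der_sub 1 G) nNG.
rewrite quotientSK // -norm_joinEr; first by rewrite [in X in _ \subset X]e.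
by apply: subset_trans nNG'; rewrite commg_subl gFnorm.
Qed.

End FrattiniCommutator.

Lemma abelem_functional (gT : finGroupType) (p : nat) (E B : {group gT})
    (abE : p.-abelem E) (ntE : E :!=: 1) : prime p -> B \proper E ->
  exists2 f : 'cV['F_p]_('dim E), f != 0%R &
    forall x, x \in B -> ev (abelem_rV abE ntE x) f = 0%R.
Proof.
move=> p_pr /andP[sBE not_sEB]; pose L := (abelem_rV abE ntE @* B)%G.
pose A := rowg_mx L.
have defL : rowg A = L by apply: rowg_mxK.
have nfA : ~~ row_full A.
  apply: contra not_sEB => fA; apply/subsetP=> x Ex.
  have : abelem_rV abE ntE x \in L by rewrite -defL inE submx_full.
  by case/morphimP=> y Ey By /(abelem_rV_inj Ex Ey) ->.
have : cokermx A != 0%R by rewrite cokermx_eq0.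
rewrite -trmx_eq0 => /rowV0Pn[r sr nz_r]; exists r^T%R; first by rewrite trmx_eq0.
move=> x Bx; have : (abelem_rV abE ntE x <= A)%MS.
  by rewrite -mem_rowg defL mem_morphim // (subsetP sBE).
case/submxP=> a ->; case/submxP: sr => d ->.
by rewrite trmx_mul trmxK /ev -mulmxA (mulmxA A) mulmx_coker mul0mx mulmx0 mxE.
Qed.

(** * The commutator map on the Frattini quotient *)

Section CommutatorMap.

Variables (gT : finGroupType) (p : nat) (G : {group gT}).
Hypotheses (p_pr : prime p) (pG : p.-group G) (nonab : G^`(1) != 1).
Local Notation Phi := 'Phi(G).
Local Notation D := [~: Phi, G].
Local Notation G' := (G^`(1)).

Lemma quotient_Phi_neq1 : G / Phi != 1.
Proof.
have ntG : G :!=: 1 by apply: contraNneq nonab => G1; rewrite -subG1 -G1 der_sub.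
apply/negP=> /eqP/trivgP; rewrite quotient_sub1 ?gFnorm // => sGP.
by have := Phi_proper ntG; rewrite properE sGP andbF.
Qed.

Lemma der1_comm_Phi_neq1 : G' / D != 1.
Proof.
have nD := comm_Phi_norm G.
apply/negP=> /eqP/trivgP; rewrite quotient_sub1 => [sG'D|]; last exact: subset_trans (der_sub 1 G) nD.
have := der1_sub_mul_comm_Phi pG (normal1 G) (sub1G _).
by rewrite (subset_trans sG'D) ?joing_subr // => /(_ isT); rewrite subG1 (negPf nonab).
Qed.

Local Notation n := ('dim (G / Phi)).
Local Notation w := ('dim (G' / D)).

Definition frat_rV x : 'rV['F_p]_n :=
  abelem_rV (Phi_quotient_abelem pG) quotient_Phi_neq1 (coset Phi x).
Definition comm_rV x : 'rV['F_p]_w :=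
  abelem_rV (der1_comm_Phi_abelem p_pr pG) der1_comm_Phi_neq1 (coset D x).
Local Notation v := frat_rV.
Local Notation om := comm_rV.

Let nPhi : G \subset 'N(Phi). Proof. exact: gFnorm. Qed.
Let nD : G \subset 'N(D). Proof. exact: comm_Phi_norm. Qed.
Let nD' : G' \subset 'N(D). Proof. exact: subset_trans (der_sub 1 G) nD. Qed.

Lemma frat_rVM : {in G &, {morph v : x y / x * y >-> (x + y)%R}}.
Proof.
move=> x y Gx Gy; rewrite /frat_rV morphM ?(subsetP nPhi) //.
by rewrite abelem_rV_M // mem_quotient.
Qed.

Lemma frat_rV_eq0 x : x \in G -> (v x == 0%R) = (x \in Phi).
Proof.
move=> Gx; rewrite /frat_rV -(abelem_rV_1 (Phi_quotient_abelem pG) quotient_Phi_neq1).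
rewrite (inj_in_eq (@abelem_rV_inj _ _ _ _ _)) ?group1 ?mem_quotient //.
by apply/eqP/idP=> [/coset_idr->|/coset_id] //; apply: (subsetP nPhi).
Qed.

Lemma frat_rVV x : x \in G -> v x^-1 = (- v x)%R.
Proof.
by move=> Gx; rewrite /frat_rV morphV ?(subsetP nPhi) // abelem_rV_V // mem_quotient.
Qed.

Lemma frat_rVX x i : x \in G -> v (x ^+ i) = (i%:R *: v x)%R.
Proof.
by move=> Gx; rewrite /frat_rV morphX ?(subsetP nPhi) // abelem_rV_X // mem_quotient.
Qed.

Lemma frat_rV_surj a : exists2 x, x \in G & v x = a.
Proof.
have := mem_rVabelem (Phi_quotient_abelem pG) quotient_Phi_neq1 a.
by case/morphimP=> x _ Gx e; exists x => //; rewrite /frat_rV -e rVabelemK.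
Qed.

Lemma comm_rVM : {in G' &, {morph om : x y / x * y >-> (x + y)%R}}.
Proof.
move=> x y Gx Gy; rewrite /comm_rV morphM ?(subsetP nD') //.
by rewrite abelem_rV_M // mem_quotient.
Qed.

Lemma comm_rV_eq0 x : x \in D -> om x = 0%R.
Proof. by move=> Dx; rewrite /comm_rV coset_id // abelem_rV_1. Qed.

Lemma comm_rV_mem x : x \in G' -> om x = 0%R -> x \in D.
Proof.
move=> Gx; rewrite /comm_rV -(abelem_rV_1 (der1_comm_Phi_abelem p_pr pG) der1_comm_Phi_neq1).
move/abelem_rV_inj; rewrite ?group1 ?mem_quotient // => /(_ isT isT)/coset_idr-> //.
exact: (subsetP nD').
Qed.

Lemma comm_rV1 : om 1 = 0%R.
Proof. by rewrite comm_rV_eq0. Qed.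

Lemma comm_rVV x : x \in G' -> om x^-1 = (- om x)%R.
Proof.
by move=> Gx; rewrite /comm_rV morphV ?(subsetP nD') // abelem_rV_V // mem_quotient.
Qed.

Lemma comm_rV_surj a : exists2 x, x \in G' & om x = a.
Proof.
have := mem_rVabelem (der1_comm_Phi_abelem p_pr pG) der1_comm_Phi_neq1 a.
by case/morphimP=> x _ Gx e; exists x => //; rewrite /comm_rV -e rVabelemK.
Qed.

Lemma comm_rVJ t z : t \in G' -> z \in G -> om (t ^ z) = om t.
Proof.
move=> Gt Gz; have Dtz : [~ t, z] \in D by rewrite (subsetP (der1_comm_sub pG)) ?mem_commg.
by rewrite conjg_mulR comm_rVM ?(comm_rV_eq0 Dtz) ?addr0 // (subsetP (comm_Phi_sub_der1 G)).
Qed.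

Lemma comm_rV_commMl x z y : x \in G -> z \in G -> y \in G ->
  om [~ x * z, y] = (om [~ x, y] + om [~ z, y])%R.
Proof.
move=> Gx Gz Gy; rewrite commMgJ comm_rVM ?comm_rVJ ?mem_commg //.
by rewrite memJ_norm ?mem_commg // (subsetP (gFnorm _ G)).
Qed.

Lemma comm_rV_anti x y : x \in G -> y \in G -> om [~ x, y] = (- om [~ y, x])%R.
Proof. by move=> Gx Gy; rewrite -invg_comm comm_rVV ?mem_commg. Qed.

(** [x] and [x'] differ by an element of Phi(G), whose commutators with G lie in [D]. *)
Lemma comm_rV_congl x x' y : x \in G -> x' \in G -> y \in G -> v x = v x' ->
  om [~ x, y] = om [~ x', y].
Proof.
move=> Gx Gx' Gy e; have Pf : x'^-1 * x \in Phi.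
  by rewrite -frat_rV_eq0 ?groupM ?groupV // frat_rVM ?groupV // frat_rVV // e addNr.
have Gf : x'^-1 * x \in G by rewrite groupM ?groupV.
rewrite -{1}(mulKVg x' x) comm_rV_commMl //.
by rewrite [X in (_ + X)%R]comm_rV_eq0 ?addr0 // mem_commg.
Qed.

Definition frat_lift a := odflt 1 [pick x in G | v x == a].

Lemma frat_liftP a : frat_lift a \in G /\ v (frat_lift a) = a.
Proof.
rewrite /frat_lift; case: pickP => [x /andP[Gx /eqP]|none] //.
by have [x Gx e] := frat_rV_surj a; have := none x; rewrite /= Gx e eqxx.
Qed.

Definition comm_map a b := om [~ frat_lift a, frat_lift b].

Lemma comm_mapE x y : x \in G -> y \in G -> comm_map (v x) (v y) = om [~ x, y].
Proof.
move=> Gx Gy; rewrite /comm_map.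
have [Gx' ex] := frat_liftP (v x); have [Gy' ey] := frat_liftP (v y).
rewrite (comm_rV_congl Gx' Gx Gy' ex) comm_rV_anti // (comm_rV_congl Gy' Gy Gx ey).
by rewrite -comm_rV_anti.
Qed.

Lemma comm_map_anti a b : comm_map a b = (- comm_map b a)%R.
Proof.
have [x Gx <-] := frat_rV_surj a; have [y Gy <-] := frat_rV_surj b.
by rewrite !comm_mapE // comm_rV_anti.
Qed.

Lemma comm_map_alt a : comm_map a a = 0%R.
Proof. by have [x Gx <-] := frat_rV_surj a; rewrite comm_mapE // commgg comm_rV1. Qed.

Lemma comm_mapD a b d : comm_map (a + b)%R d = (comm_map a d + comm_map b d)%R.
Proof.
have [x Gx <-] := frat_rV_surj a; have [y Gy <-] := frat_rV_surj b.
have [z Gz <-] := frat_rV_surj d.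
by rewrite -frat_rVM // !comm_mapE ?groupM // comm_rV_commMl.
Qed.

Lemma comm_map_linl s a b d :
  comm_map (s *: a + b)%R d = (s *: comm_map a d + comm_map b d)%R.
Proof.
rewrite comm_mapD; congr (_ + _)%R; rewrite -[s]natr_Zp !scaler_nat.
elim: (s : nat) => [|m IH]; last by rewrite !mulrS comm_mapD IH.
have := comm_mapD 0%R 0%R d; rewrite addr0 => /eqP.
by rewrite -[X in X == _]addr0 (inj_eq (addrI _)) => /eqP <-.
Qed.

Lemma comm_map_span (f : 'cV['F_p]_w) :
  (forall a b, comm_map a b *m f = 0)%R -> f = 0%R.
Proof.
move=> cf; pose S := [set t in G' | om t *m f == 0]%R.
have gS : group_set S.
  apply/group_setP; split=> [|s t]; first by rewrite inE group1 comm_rV1 mul0mx /=.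
  rewrite !inE => /andP[Gs /eqP fs] /andP[Gt /eqP ft].
  by rewrite groupM //= comm_rVM // mulmxDl fs ft addr0.
have sub : G' \subset Group gS.
  rewrite gen_subG; apply/subsetP=> _ /imset2P[x y Gx Gy ->].
  by rewrite inE mem_commg //= -comm_mapE // cf.
apply: ev_inj => a; have [t Gt <-] := comm_rV_surj a.
have := subsetP sub t Gt; rewrite inE => /andP[_ /eqP e].
by rewrite /ev e mulmx0.
Qed.

End CommutatorMap.

(** * The minimal counterexample *)

Lemma ev_eq0 (F : finFieldType) n (x : 'rV[F]_n) (al : 'cV[F]_n) :
  (ev x al == 0%R) = (x <= kermx al)%MS.
Proof.
rewrite (sameP sub_kermxP eqP); apply/eqP/eqP=> [e|e]; last by rewrite /ev e mxE.
by rewrite [LHS]mx11_scalar -/(ev x al) e raddf0.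
Qed.

Lemma card_class_pgroup (gT : finGroupType) (p : nat) (G : {group gT}) x :
  p.-group G -> exists k, #|x ^: G| = (p ^ k)%N.
Proof.
move=> pG; rewrite -index_cent1.
by have [k ->] := p_natP (pnat_dvd (dvdn_indexg G 'C_G[x]) pG); exists k.
Qed.

Lemma bin2_addn a d : 'C(a + d, 2) = ('C(a, 2) + a * d + 'C(d, 2))%N.
Proof.
elim: d => [|d IHd]; first by rewrite muln0 !addn0.
by rewrite addnS !binS !bin1 IHd; lia.
Qed.

Lemma leq_exponents a s k m d e : (a + s <= k)%N ->
  (a + (e + d + (m * d + s)) <= k + m.+1 * d + e)%N.
Proof. by rewrite mulSn; lia. Qed.

Section MinimalCounterexample.

Variables (gT : finGroupType) (p : nat) (G M : {group gT}) (b : nat).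
Hypotheses (p_pr : prime p) (pG : p.-group G) (nonab : G^`(1) != 1).
Hypothesis maxM : maximal M G.
Hypothesis small : forall x, x \in G -> x \notin M -> (#|x ^: G| <= p ^ b)%N.
Hypothesis IH : forall (H N : {group gT}) b', H \proper G -> N \proper H ->
  (forall x, x \in H -> x \notin N -> (#|x ^: H| <= p ^ b')%N) ->
  (#|H^`(1)| <= p ^ 'C(b'.+1, 2))%N.
Hypothesis big : (p ^ 'C(b.+1, 2) < #|G^`(1)|)%N.

Local Notation Phi := 'Phi(G).
Local Notation D := [~: Phi, G].
Local Notation G' := (G^`(1)).
Local Notation n := ('dim (G / Phi)).
Local Notation w := ('dim (G' / D)).
Local Notation v := (frat_rV pG nonab).
Local Notation om := (comm_rV p_pr pG nonab).
Local Notation c := (comm_map p_pr pG nonab).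

Definition frat_pre m (A : 'M['F_p]_(m, n)) := [set x in G | (v x <= A)%MS].

Lemma frat_pre_group_set m (A : 'M_(m, n)) : group_set (frat_pre A).
Proof.
apply/group_setP; split=> [|x y].
  rewrite inE group1; have /eqP-> : v 1 == 0%R by rewrite frat_rV_eq0 ?group1.
  by rewrite sub0mx.
rewrite !inE => /andP[Gx Ax] /andP[Gy Ay].
by rewrite groupM //= frat_rVM // addmx_sub.
Qed.
Canonical frat_pre_group m (A : 'M_(m, n)) := Group (frat_pre_group_set A).

Lemma frat_pre_sub m (A : 'M_(m, n)) : frat_pre A \subset G.
Proof. by apply/subsetP=> x; rewrite inE => /andP[]. Qed.

Lemma Phi_sub_frat_pre m (A : 'M_(m, n)) : Phi \subset frat_pre A.
Proof.
apply/subsetP=> x Px; have Gx := subsetP (Phi_sub G) x Px.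
by rewrite inE Gx; move: Px; rewrite -(frat_rV_eq0 pG nonab) // => /eqP->; rewrite sub0mx.
Qed.

Lemma frat_pre_normal m (A : 'M_(m, n)) : frat_pre A <| G.
Proof.
apply: sub_der1_normal (frat_pre_sub A).
exact: subset_trans (der1_sub_Phi pG) (Phi_sub_frat_pre A).
Qed.

Lemma index_frat_pre_Phi m (A : 'M_(m, n)) : #|frat_pre A : Phi| = (p ^ \rank A)%N.
Proof.
rewrite -card_quotient; last exact: subset_trans (frat_pre_sub A) (gFnorm _ G).
have sE : frat_pre A / Phi \subset G / Phi by rewrite quotientS ?frat_pre_sub.
rewrite -(card_injm (abelem_rV_injm (Phi_quotient_abelem pG) (quotient_Phi_neq1 nonab)) sE).
transitivity #|rowg A|; last by rewrite card_rowg card_Fp.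
apply: eq_card => a; rewrite [RHS]inE; apply/morphimP/idP=> [[_ _ /morphimP[x _ Ax ->] ->]|Aa].
  by move: Ax; rewrite inE => /andP[].
have [x Gx e] := frat_rV_surj pG nonab a.
by exists (coset Phi x); rewrite ?mem_quotient // inE Gx e.
Qed.

Lemma index_frat_pre m (A : 'M_(m, n)) : (#|G : frat_pre A| * p ^ \rank A = p ^ n)%N.
Proof.
rewrite -index_frat_pre_Phi Lagrange_index ?frat_pre_sub ?Phi_sub_frat_pre //.
have -> : (p ^ n)%N = #|frat_pre (1%:M : 'M_n) : Phi| by rewrite index_frat_pre_Phi mxrank1.
by congr #|_ : _|; apply/setP=> x; rewrite inE submx1 andbT.
Qed.

Lemma index_frat_pre_ker k (Q : 'M_(n, k)) : #|G : frat_pre (kermx Q)| = (p ^ \rank Q)%N.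
Proof.
have e : (p ^ n = p ^ (n - \rank Q) * p ^ \rank Q)%N.
  by rewrite -expnD subnK ?rank_leq_row.
have := index_frat_pre (kermx Q); rewrite mxrank_ker e mulnC => /eqP.
by rewrite eqn_pmul2l ?expn_gt0 ?prime_gt0 // => /eqP.
Qed.

(** The kernel of a nonzero functional killing M / Phi(G) gives a proper subgroup containing [M], so
    it is [M] by maximality. *)
Lemma maximal_functional : exists2 u : 'cV['F_p]_n, u != 0%R &
  forall x, x \in G -> (ev (v x) u == 0%R) = (x \in M).
Proof.
have [sMG not_sGM] := andP (maxgroupp maxM); have sPM := Phi_sub_max maxM.
have prM : M / Phi \proper G / Phi.
  rewrite properE quotientS //= quotientSGK ?gFnorm //.
have [u nz_u u0] :=
  abelem_functional (Phi_quotient_abelem pG) (quotient_Phi_neq1 nonab) p_pr prM.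
have prK : frat_pre (kermx u) \proper G.
  rewrite properE frat_pre_sub /=; apply: contra nz_u => sub; apply/eqP/ev_inj=> a.
  have [x Gx <-] := frat_rV_surj pG nonab a; rewrite ev0r; apply/eqP; rewrite ev_eq0.
  by have := subsetP sub x Gx; rewrite inE => /andP[].
have sMK : M \subset frat_pre (kermx u).
  apply/subsetP=> x Mx; rewrite inE (subsetP sMG) //= -ev_eq0; apply/eqP/u0.
  by rewrite mem_quotient.
have [_ maxM'] := maxgroupP maxM; have e := maxM' _ prK sMK.
exists u => // x Gx; rewrite ev_eq0.
have : (x \in frat_pre (kermx u)) = (x \in M) by have /= -> := e.
by rewrite inE Gx.
Qed.

(** Otherwise all elements of the hyperplane subgroup [H = ker al] outside [M] would have
    breadth at most [b - 1] in [H], and [H] would satisfy the bound for [b - 1]. So some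
    [x] in [H] outside [M] has the same class under [H] as under [G], and is thus central
    modulo the derived subgroup of [H]. *)
Lemma exists_bad_element (u al : 'cV['F_p]_n) : u != 0%R ->
  (forall x, x \in G -> (ev (v x) u == 0%R) = (x \in M)) -> ~~ (al^T%R <= u^T%R)%MS ->
  exists x (f : 'cV_w), [/\ ev x al = 0%R, ev x u != 0%R /\ f != 0%R,
    forall y z, ev y al = 0%R -> ev z al = 0%R -> (c y z *m f = 0)%R
    & forall y, (c x y *m f = 0)%R].
Proof.
move=> nz_u uM al_u; pose H := frat_pre_group (kermx al).
have memH x : x \in G -> (x \in H) = (ev (v x) al == 0%R) by move=> Gx; rewrite inE Gx ev_eq0.
have sHG : H \subset G := frat_pre_sub _.
have nz_al : al != 0%R by apply: contraNneq al_u => ->; rewrite trmx0 sub0mx.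
have [z0 z0al] : exists z, ev z al != 0%R.
  by case/cV0Pn: nz_al => i ali; exists (delta_mx 0%R i); rewrite ev_delta.
(* If [u] vanished on all of [al = 0], it would be a multiple of [al], and [al] one of [u]. *)
have [h Hh nMh] : exists2 h, h \in H & h \notin M.
  have [a /andP[/eqP a0 au]|none] := pickP [pred a | (ev a al == 0%R) && (ev a u != 0%R)].
    have [x Gx e] := frat_rV_surj pG nonab a; exists x; first by rewrite memH // e a0.
    by rewrite -uM // e.
  pose s := (ev z0 u / ev z0 al)%R.
  have e : u = (s *: al)%R.
    apply: ev_inj => a; rewrite evZr; have := none (a - (ev a al / ev z0 al) *: z0)%R.
    rewrite /= !evBl !evZl divfK // subrr eqxx /= => /negbFE; rewrite subr_eq0 => /eqP->.
    by rewrite /s [LHS]mulrAC [RHS]mulrAC [(ev a al * _)%R]mulrC.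
  have nz_s : s != 0%R by apply: contraNneq nz_u => s0; rewrite e s0 scale0r.
  case/negP: al_u; rewrite e linearZ /=; apply/submxP; exists (s^-1)%:M%R.
  by rewrite mul_scalar_mx scalerA mulVf // scale1r.
have Gh := subsetP sHG h Hh.
have [y [Gy nHy nMy]] : exists y, [/\ y \in G, y \notin H & y \notin M].
  have [g Gg e] := frat_rV_surj pG nonab z0.
  have nHg : g \notin H by rewrite memH // e.
  have [Mg|nMg] := boolP (g \in M); last by exists g.
  by exists (g * h); rewrite groupM // groupMr // groupMl.
have genG : G \subset <<y |: H>>.
  apply/subsetP=> g Gg; pose t := (ev (v g) al / ev (v y) al)%R : 'F_p.
  have yK : y ^+ t \in <<y |: H>> by rewrite groupX // mem_gen // !inE eqxx.
  rewrite -(groupMr _ (groupVr yK)) mem_gen // inE; apply/orP; right.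
  have Gyt : y ^+ t \in G by rewrite groupX.
  rewrite memH ?groupM ?groupV // frat_rVM ?groupV // frat_rVV // frat_rVX //.
  rewrite natr_Zp evBl evZl divfK ?subrr //.
  by rewrite -memH.
have prH : H \proper G by rewrite properE sHG; apply/subsetPn; exists y.
have prHM : (H :&: M)%G \proper H.
  by rewrite properE subsetIl; apply/subsetPn; exists h; rewrite // inE Hh.
have leH x : (#|x ^: H| <= #|x ^: G|)%N by apply/subset_leq_card/imsetS.
have smallH : (#|H^`(1)| < #|G'|)%N.
  apply: leq_ltn_trans big; apply: IH prH prHM _ => x Hx; rewrite inE Hx => nMx.
  by apply: leq_trans (leH x) (small _ nMx); apply: (subsetP sHG).
have nsHG : H <| G := frat_pre_normal _.
have [x Hx /andP[nMx eqx]] : exists2 x, x \in H & (x \notin M) && (#|x ^: G| <= #|x ^: H|)%N.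
  have [x /and3P[Hx nMx ex]|none] :=
     pickP [pred x | [&& x \in H, x \notin M & (#|x ^: G| <= #|x ^: H|)%N]].
    by exists x; rewrite // nMx.
  have ltx x : x \in H -> x \notin M -> exists2 k, #|x ^: H| = (p ^ k)%N & (k < b)%N.
    move=> Hx nMx; have := none x; rewrite /= Hx nMx /= => /negbT; rewrite -ltnNge.
    have [k ek] := card_class_pgroup x (pgroupS sHG pG); rewrite ek.
    move/leq_trans/(_ (small (subsetP sHG x Hx) nMx)).
    by rewrite ltn_exp2l ?prime_gt1 // => kb; exists k.
  have b_gt0 : (0 < b)%N by have [k _] := ltx h Hh nMh; apply: leq_ltn_trans.
  have H'le : (#|H^`(1)| <= p ^ 'C(b.-1.+1, 2))%N.
    apply: IH prH prHM _ => x Hx; rewrite inE Hx => /(ltx x Hx)[k -> kb].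
    by rewrite leq_exp2l ?prime_gt1 // -ltnS prednK.
  (* The bounds p^C(b, 2) for H' and p^b for the class of [y] multiply to p^C(b+1, 2), against
     [big]. *)
  have := leq_trans (card_der1_cyclic_ext nsHG Gy genG) (leq_mul H'le (small Gy nMy)).
  rewrite leqNgt -expnD prednK // => /negP[]; apply: leq_trans big.
  by rewrite ltnS leq_exp2l ?prime_gt1 // binS bin1 addnC.
have Gx := subsetP sHG x Hx.
have eqcl : x ^: H = x ^: G by apply/eqP; rewrite eqEcard eqx andbT imsetS.
have nH'G : G \subset 'N(H^`(1)) := gFnorm_trans _ (normal_norm nsHG).
have sH'G' : H^`(1) \subset G' by rewrite dergS.
(* Equality would give G' = H' by [der1_sub_mul_comm_Phi]. *)
have prB : H^`(1) / D \proper G' / D.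
  rewrite properE quotientS //=; apply/negP; rewrite quotientSK; last first.
    exact: subset_trans (der_sub 1 G) (comm_Phi_norm G).
  move=> sG'; have : G' \subset H^`(1).
    apply: (der1_sub_mul_comm_Phi pG _ sH'G').
      by rewrite /normal (subset_trans sH'G') ?der_sub.
    by apply: subset_trans sG' _; rewrite mul_subG ?joing_subl ?joing_subr.
  by move/subset_leq_card; rewrite leqNgt smallH.
have [f nz_f f0] := abelem_functional (der1_comm_Phi_abelem p_pr pG)
  (der1_comm_Phi_neq1 pG nonab) p_pr prB.
have omf t : t \in H^`(1) -> (om t *m f = 0)%R.
  move=> Ht; have := f0 _ (mem_quotient D Ht) => /eqP; rewrite ev_eq0.
  by move/sub_kermxP.
exists (v x), f; split; first by apply/eqP; rewrite -memH.
- by rewrite uM.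
- move=> y1 z1 y0 zz0; have [yy Gyy ey] := frat_rV_surj pG nonab y1.
  have [zz Gzz ez] := frat_rV_surj pG nonab z1; rewrite -ey -ez comm_mapE // omf //.
  by rewrite mem_commg // memH // ?ey ?ez ?y0 ?zz0.
move=> y1; have [g Gg <-] := frat_rV_surj pG nonab y1; rewrite comm_mapE // omf //.
(* The [G]-class of [x] is its [H]-class, so [x, g] = [x, k] for some [k] in [H]. *)
have : x ^ g \in x ^: H by rewrite eqcl memJ_class.
case/imsetP=> k Hk e; rewrite commgEl e -commgEl mem_commg //.
Qed.

Lemma no_minimal_counterexample : False.
Proof.
have p_gt1 := prime_gt1 p_pr.
have [u nz_u uM] := maximal_functional.
have [B [uB Bu [i0 ri0] wle]] := good_slice_basis (comm_map_linl p_pr pG nonab)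
  (comm_map_alt p_pr pG nonab) (comm_map_anti p_pr pG nonab)
  (comm_map_span (p_pr := p_pr) (pG := pG) (nonab := nonab))
  (fun al => exists_bad_element nz_u uM (al := al)) nz_u.
set N := adm c in ri0 wle.
have admc x y : (y *m N x)%R = c x y.
  exact: (admE (comm_map_linl p_pr pG nonab) (comm_map_anti p_pr pG nonab)).
have cZl := altZl (comm_map_linl p_pr pG nonab).
have cZr := altZr (comm_map_linl p_pr pG nonab) (comm_map_anti p_pr pG nonab).
pose x i := frat_lift pG nonab (row i B).
have Gx i : x i \in G by case: (frat_liftP pG nonab (row i B)).
have vx i : v (x i) = row i B by case: (frat_liftP pG nonab (row i B)).
have nMx i : x i \notin M by rewrite -uM // vx Bu oner_neq0.
(* [w] is a successor by the definition of 'dim, so [wle] makes 'C(n, 2) positive. *)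
have n_gt1 : (1 < n)%N 
  by rewrite ltnNge; apply/negP=> n1; move: wle; rewrite bin_small.
have rowB0 i : row i B != 0%R.
  by apply: contraTneq (oner_neq0 'F_p) => e; rewrite -(Bu i) e /ev mul0mx mxE eqxx.
pose K := frat_pre_group (row i0 B).
have sKG : K \subset G := frat_pre_sub _.
have nsKG : K <| G := frat_pre_normal _.
have sPK : Phi \subset K := Phi_sub_frat_pre _.
have Kx : x i0 \in K by rewrite inE Gx vx /=.
have nPx : x i0 \notin Phi by rewrite -(frat_rV_eq0 pG nonab) ?vx.
have idxK : #|G : K| = (p ^ n.-1)%N.
  have := index_frat_pre (row i0 B); rewrite rank_rV rowB0 expn1.
  have -> : (p ^ n = p ^ n.-1 * p)%N by rewrite -expnSr.
  by move/eqP; rewrite eqn_pmul2r ?prime_gt0 // => /eqP.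
have prK : K \proper G.
  rewrite properEneq sKG andbT; apply: contraTneq n_gt1 => e.
  by move/eqP: idxK; rewrite e indexgg eq_sym -(expn0 p) eqn_exp2l // => /eqP /= ->.
have prP : 'Phi(G)%G \proper K by rewrite properE sPK; apply/subsetPn; exists (x i0).
have KM z : z \in K -> z \notin Phi -> z \notin M.
  rewrite inE => /andP[Gz /sub_rVP[t e]]; rewrite -(frat_rV_eq0 pG nonab) // -uM // e.
  by rewrite evZl Bu mulr1; apply: contra => /eqP->; rewrite scale0r.
(* As r(x_i0) = n - 1, the kernel of c(x_i0, .) is the line spanned by [row i0 B]. *)
have CK z : z \in K -> z \notin Phi -> 'C_G[z] \subset K.
  rewrite inE => /andP[Gz /sub_rVP[t e]]; rewrite -(frat_rV_eq0 pG nonab) // e => nz.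
  have nz_t : t != 0%R by apply: contraNneq nz => ->; rewrite scale0r.
  apply/subsetP=> y /setIP[Gy /cent1P zy]; rewrite inE Gy /=.
  have cy : c (row i0 B) (v y) = 0%R.
    have : c (v z) (v y) = 0%R.
      by rewrite comm_mapE // (eqP (_ : [~ z, y] == 1)) ?comm_rV1 //; apply/commgP.
    by rewrite e cZl => /eqP; rewrite scaler_eq0 (negPf nz_t) => /eqP.
  have sk : (row i0 B <= kermx (N (row i0 B)))%MS.
    by apply/sub_kermxP; rewrite admc comm_map_alt.
  have := mxrank_leqif_sup sk; rewrite rank_rV rowB0 mxrank_ker ri0.
  have -> : (n - n.-1 = 1)%N by rewrite subSnn.
  case=> _ /esym; rewrite eqxx => kr; apply: submx_trans kr.
  by apply/sub_kermxP; rewrite admc.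
(* [K = <x i0> Phi] contains the centralizers of its elements outside [Phi], so that
   there the breadth in [K] drops by the full amount [n - 1]. *)
have smallK z : z \in K -> z \notin Phi -> (p ^ n.-1 * #|z ^: K| <= p ^ b)%N.
  move=> Kz nPz; rewrite -idxK -card_class_index ?CK //.
  by apply: small; [apply: (subsetP sKG) | apply: KM].
have cl_gt0 z : (0 < #|z ^: K|)%N by rewrite (cardD1 z) class_refl.
have nb : (n.-1 <= b)%N.
  rewrite -(leq_exp2l _ _ p_gt1); apply: leq_trans (smallK _ Kx nPx).
  by rewrite leq_pmulr.
pose d := (b - n.-1)%N.
have K'le : (#|K^`(1)| <= p ^ 'C(d.+1, 2))%N.
  apply: IH prK prP _ => z Kz nPz.
  have := smallK z Kz nPz; rewrite -{1}(subnKC nb) expnD leq_pmul2l //.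
  by rewrite expn_gt0 prime_gt0.
have nK'G : G \subset 'N(K^`(1)) := gFnorm_trans _ (normal_norm nsKG).
have sP'K' : [~: Phi, K] \subset K^`(1) by rewrite commSg.
(* [K] is cyclic modulo Phi(G) and [c] is alternating. *)
have sK'D : K^`(1) \subset D.
  rewrite gen_subG; apply/subsetP=> _ /imset2P[y z Ky Kz ->].
  have Gy := subsetP sKG y Ky; have Gz := subsetP sKG z Kz.
  move: Ky Kz; rewrite !inE Gy Gz => /sub_rVP[s ey] /sub_rVP[t ez].
  apply: (comm_rV_mem (p_pr := p_pr) (pG := pG) (nonab := nonab)); first by rewrite mem_commg.
  by rewrite -comm_mapE // ey ez cZl cZr comm_map_alt !scaler0.
have nK'P : Phi \subset 'N(K^`(1)) := subset_trans (Phi_sub G) nK'G.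
have genG : G \subset <<Phi :|: [set x i | i in 'I_n]>>.
  set T := <<_>>; have sPT : Phi \subset T := subset_trans (subsetUl _ _) (subset_gen _).
  have sTG : T \subset G.
    rewrite gen_subG subUset Phi_sub; apply/subsetP=> _ /imsetP[i _ ->]; exact: Gx.
  apply/negPn/negP=> not_sGT.
  have prT : T / Phi \proper G / Phi.
    by rewrite properE quotientS //= quotientSGK ?gFnorm.
  have [f nz_f f0] :=
    abelem_functional (Phi_quotient_abelem pG) (quotient_Phi_neq1 nonab) p_pr prT.
  case/eqP: nz_f; rewrite -[f](mulKmx uB); have -> : (B *m f = 0)%R; last by rewrite mulmx0.
  apply/matrixP=> i j; rewrite !ord1 [RHS]mxE.
  have Tx : x i \in T by apply/mem_gen/setUP; right; apply: imset_f.
  by have := f0 _ (mem_quotient Phi Tx); rewrite -/(v (x i)) vx /ev -row_mul mxE.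
(* The preimage [L] of the kernel of c(x_i, .) has index p^r(x_i) and contains the centralizer of
   x_i, so passing from [G] to [L] divides the class size by that index. *)
have clPhi i : (#|x i ^: Phi| <= p ^ (b - \rank (N (row i B))))%N.
  pose L := frat_pre_group (kermx (N (row i B))).
  have CL : 'C_G[x i] \subset L.
    apply/subsetP=> y /setIP[Gy /cent1P xy]; rewrite inE Gy /=; apply/sub_kermxP.
    by rewrite admc -vx comm_mapE // (eqP (_ : [~ x i, y] == 1)) ?comm_rV1 //; apply/commgP.
  have := small (Gx i) (nMx i).
  rewrite (card_class_index (frat_pre_sub _) CL) index_frat_pre_ker => le.
  have L_gt0 : (0 < #|x i ^: L|)%N by rewrite (cardD1 (x i)) class_refl.
  have rb : (\rank (N (row i B)) <= b)%N.
    by rewrite -(leq_exp2l _ _ p_gt1); apply: leq_trans le; rewrite leq_pmulr.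
  move: le; rewrite -{1}(subnKC rb) expnD leq_pmul2l ?expn_gt0 ?prime_gt0 //.
  by apply: leq_trans; apply/subset_leq_card/imsetS/Phi_sub_frat_pre.
have Dle : (#|D / K^`(1)| <= \prod_(i | i != i0) p ^ (b - \rank (N (row i B))))%N.
  pose y i := coset K^`(1) (x i).
  have nA : Phi / K^`(1) <| G / K^`(1) by rewrite quotient_normal // gFnormal.
  have cA : abelian (Phi / K^`(1)).
    by rewrite /abelian quotient_cents2 // (subset_trans _ sP'K') ?commgS.
  have Ncl i : y i ^: (Phi / K^`(1)) \subset coset K^`(1) @: (x i ^: Phi).
    apply/subsetP=> _ /imsetP[_ /morphimP[f Nf Pf ->] ->].
    have Gf := subsetP (Phi_sub G) f Pf.
    by rewrite /y -morphJ ?(subsetP nK'G) //=; apply/imset_f/memJ_class.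
  rewrite quotientR //.
  have := @card_comm_abelian_normal _ _ _ cA nA [seq y i | i <- enum 'I_n].
  rewrite big_map big_enum (bigD1 i0) //= => /(_ _ _)/leq_trans -> //.
  - by move=> _ /mapP[i _ ->]; rewrite mem_quotient.
  - apply: subset_trans (quotientS _ genG) _; rewrite quotient_gen; last first.
      rewrite subUset nK'P; apply/subsetP=> _ /imsetP[i _ ->]; exact: (subsetP nK'G).
    apply: genS; rewrite quotientU setUS //; apply/subsetP=> _ /morphimP[_ _ /imsetP[i _ ->] ->].
    by rewrite inE; apply: map_f; rewrite mem_enum.
  (* The factor for [i0] is 1, since [Phi(G), x_i0] lies in K'. *)
  rewrite -[X in (_ <= X)%N]mul1n leq_mul //.
    apply: leq_trans (eq_leq (cards1 (y i0))); apply/subset_leq_card/subsetP=> _ /imsetP[_ /morphimP[f Nf Pf ->] ->].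
    have Gf := subsetP (Phi_sub G) f Pf.
    have cid : coset K^`(1) [~ x i0, f] = 1.
      by apply: coset_id; rewrite -invg_comm groupV (subsetP sP'K') // mem_commg.
    rewrite inE /y -morphJ ?(subsetP nK'G) // conjg_mulR.
    by rewrite morphM ?(subsetP nK'G) ?groupR //= cid mulg1.
  apply: leq_prod => i _; apply: leq_trans (clPhi i).
  exact: leq_trans (subset_leq_card (Ncl i)) (leq_imset_card _ _).
have D_le : (#|D| <= p ^ (\sum_(i | i != i0) (b - \rank (N (row i B))) + 'C(d.+1, 2)))%N.
  rewrite expnD expn_sum -(Lagrange sK'D) -card_quotient; last first.
    exact: subset_trans (comm_Phi_sub_der1 G) (subset_trans (der_sub 1 G) nK'G).
  by rewrite mulnC leq_mul.
have cG' : #|G'| = (p ^ w * #|D|)%N.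
  rewrite -(Lagrange (comm_Phi_sub_der1 G)) mulnC; congr (_ * _)%N.
  rewrite -card_quotient; last exact: subset_trans (der_sub 1 G) (comm_Phi_norm G).
  have := card_abelem_rV (der1_comm_Phi_abelem p_pr pG) (der1_comm_Phi_neq1 pG nonab).
  by rewrite card_mx mul1n card_Fp.
move: big; rewrite ltnNge => /negP[]; rewrite cG'.
apply: leq_trans (leq_mul (leqnn _) D_le) _; rewrite -expnD leq_exp2l //.
have rle i : (\rank (N (row i B)) <= n.-1)%N.
  exact: (rank_adm (comm_map_linl p_pr pG nonab) (comm_map_alt p_pr pG nonab)
    (comm_map_anti p_pr pG nonab) (rowB0 i)).
(* Each b - r(x_i) is d + (n - 1 - r(x_i)); the second part is 0 at [i0]. *)
have -> : (\sum_(i | i != i0) (b - \rank (N (row i B))) =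
           n.-1 * d + \sum_i (n.-1 - \rank (N (row i B))))%N.
  rewrite [in RHS](bigD1 i0) //= ri0 subnn add0n.
  have -> : (n.-1 * d = \sum_(i < n | i != i0) d)%N.
    by rewrite sum_nat_const cardC1 card_ord.
  rewrite -big_split; apply: eq_bigr => i _ /=.
  by rewrite addnBA // subnK.
(* C(n + d, 2) = C(n, 2) + n d + C(d, 2) absorbs C(d + 1, 2) = C(d, 2) + d; the rest is [wle]. *)
have -> : b.+1 = (n + d)%N by rewrite /= addSn subnKC.
rewrite bin2_addn [X in (_ + X <= _)%N]addnC binS bin1 /=.
exact: leq_exponents.
Qed.

End MinimalCounterexample.

(** * Induction on the group order and conclusion *)

Lemma card_der1_le (gT : finGroupType) (p : nat) (G M : {group gT}) b :
  prime p -> p.-group G -> M \proper G ->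
  (forall x, x \in G -> x \notin M -> (#|x ^: G| <= p ^ b)%N) ->
  (#|G^`(1)| <= p ^ 'C(b.+1, 2))%N.
Proof.
move=> p_pr; move: {2}#|G|.+1 (ltnSn #|G|) => m; elim: m => // m IHm in G M b *.
move=> leGm pG prM small; rewrite leqNgt; apply/negP=> big.
have [nabG | nab] := eqVneq G^`(1) 1.
  by move: big; rewrite nabG cards1 ltnNge expn_gt0 prime_gt0.
(* Enlarging [M] to a maximal subgroup keeps the breadth bound, as fewer elements lie outside. *)
have [eMG | [M' maxM' sMM']] := maximal_exists (proper_sub prM).
  by move: prM; rewrite eMG properxx.
apply: (@no_minimal_counterexample _ p G M' b p_pr pG nab maxM') => //.
  by move=> x Gx nMx; apply: small Gx _; apply: contra nMx; apply: (subsetP sMM').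
move=> H N b' prH prN; apply: IHm prN; last exact: pgroupS (proper_sub prH) pG.
exact: leq_trans (proper_card prH) _.
Qed.

Theorem theorem1p1 (gT : finGroupType) (p : nat) (G : {group gT}) (n : nat) :
  prime p -> p.-group G ->
  (p ^ (n * (n - 1) %/ 2) < #|G^`(1)|)%N ->
  <<[set x in G | (n <= breadth p G x)%N]>> = G.
Proof.
move=> p_pr pG; set S := [set x in G | _] => big.
have sSG : <<S>> \subset G by rewrite gen_subG; apply/subsetP=> x; rewrite inE => /andP[].
apply/eqP; rewrite eqEproper sSG /=; apply/negP=> prS.
have below x : x \in G -> x \notin <<S>>%G -> (breadth p G x < n)%N.
  by move=> Gx; rewrite ltnNge; apply: contra => nb; apply: mem_gen; rewrite inE Gx.
(* An element outside the generated subgroup has breadth below [n], so [n] is some b + 1, and all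
   breadths outside are at most b. *)
have [_ [x Gx /(below x Gx)]] := properP prS; case: n @S big sSG prS below => // b S big _ prS below _.
move: big; rewrite subn1 divn2 -bin2 ltnNge => /negP[].
apply: (card_der1_le p_pr pG prS) => y Gy /(below y Gy).
have [k ek] := card_class_pgroup y pG.
by rewrite /breadth index_cent1 ek pfactorK // ltnS leq_exp2l ?prime_gt1.
Qed.
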